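(* For $p>-1$ and $x>0$ let $R_p(x)=\int_0^\infty t^pe^{-t^2/2}e^{-xt}\,dt$. Let $n\ge 2$ and let $\boldsymbol{p}=(p_1,\dots,p_n)$, $\boldsymbol{q}=(q_1,\dots,q_n)\in(-1,\infty)^n$ satisfy $\boldsymbol{p}\prec\boldsymbol{q}$. For real $\lambda_n$ put $$\mathcal{D}(x;\lambda_n)=\prod_{j=1}^nR_{p_j}(x)-\lambda_n\prod_{j=1}^nR_{q_j}(x).$$ Then $x\mapsto\mathcal{D}(x;\lambda_n)$ is completely monotonic on $(0,\infty)$ if and only if $$\lambda_n\le\prod_{j=1}^n\frac{\Gamma(p_j+1)}{\Gamma(q_j+1)},$$ while $x\mapsto-\mathcal{D}(x;\lambda_n)$ is completely monotonic on $(0,\infty)$ if $\lambda_n\ge 1$. Consequently, the inequality $$\prod_{j=1}^n\frac{\Gamma(p_j+1)}{\Gamma(q_j+1)}<\prod_{j=1}^n\frac{R_{p_j}(x)}{R_{q_j}(x)}<1$$ holds for $x>0$, where the lower bound is sharp (it cannot be replaced by a larger constant).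
   Context: A function $h$ is completely monotonic on an interval $I$ if it has derivatives of all orders on $I$ and $(-1)^m h^{(m)}(x)\ge 0$ for all integers $m\ge 0$ and all $x\in I$. For $x=(x_1,\dots,x_n)$ and $y=(y_1,\dots,y_n)$ in $\mathbb{R}^n$, $y\prec x$ means: $x\ne y$, $x_1\ge x_2\ge\cdots\ge x_n$, $y_1\ge y_2\ge\cdots\ge y_n$, $\sum_{j=1}^{m}x_j\ge\sum_{j=1}^{m}y_j$ for $m=1,\dots,n-1$, and $\sum_{j=1}^n x_j=\sum_{j=1}^n y_j$. *)

(* Defs.v *)
(* MathComp-Analysis *)
From HB Require Import structures.
From mathcomp Require Import all_boot all_order all_algebra.
From mathcomp Require Import all_classical all_reals all_analysis.

Set Implicit Arguments.
Unset Strict Implicit.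
Unset Printing Implicit Defensive.

Import Order.TTheory GRing.Theory Num.Theory.
Import numFieldNormedType.Exports.

Local Open Scope classical_set_scope.
Local Open Scope ring_scope.

(* [derive1n] and [derivable] are two-sided, so this is the usual notion when
   I is open.  Derivability is required at every order and every point of I,
   so the default value of [derive1n] at a non-derivable point never
   intervenes. *)
Definition completely_monotonic (R : realType) (I : interval R) (h : R -> R) :
    Prop :=
  forall (m : nat) (x : R), x \in I ->
    derivable (derive1n m h) x 1 /\ 0 <= (-1) ^+ m * derive1n m h x.

(* [majorized y x] is y ≺ x: the larger vector x comes second.  The partial
   sums x_1 + ... + x_m range over the indices j < m, counted from 0. *)
Definition majorized (R : realType) (n : nat) (y x : 'rV[R]_n) : Prop :=
  [/\ x <> y,
      forall i j : 'I_n, (i <= j)%N -> x 0 j <= x 0 i,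
      forall i j : 'I_n, (i <= j)%N -> y 0 j <= y 0 i,
      forall m : nat, (1 <= m <= n.-1)%N ->
        \sum_(j < n | (j < m)%N) y 0 j <= \sum_(j < n | (j < m)%N) x 0 j
    & \sum_(j < n) x 0 j = \sum_(j < n) y 0 j].

(* The improper integrals over (0, +oo) below have nonnegative integrands and
   are taken as Lebesgue integrals.  [Rintegral] sends an infinite integral to
   0, which concerns only s <= 0 in [Gamma] and p <= -1 in [laplace_gauss]. *)
Definition Gamma (R : realType) (s : R) : R :=
  \int[@lebesgue_measure R]_(t in `]0, +oo[) (t `^ (s - 1) * expR (- t)).

(* R_p(x) *)
Definition laplace_gauss (R : realType) (p x : R) : R :=
  \int[@lebesgue_measure R]_(t in `]0, +oo[)
    (t `^ p * expR (- (t ^+ 2 / 2)) * expR (- (x * t))).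

(* D(x; lambda_n) *)
Definition prod_diff (R : realType) (n : nat) (p q : 'rV[R]_n) (lambda x : R) :
    R :=
  \prod_(j < n) laplace_gauss (p 0 j) x
  - lambda * \prod_(j < n) laplace_gauss (q 0 j) x.

(* Main.v *)
Require Import Defs.
From mathcomp Require Import all_boot all_order all_algebra.
From mathcomp Require Import all_classical all_reals all_analysis.
From mathcomp Require Import measurable_realfun ring lra.

Set Implicit Arguments.
Unset Strict Implicit.
Unset Printing Implicit Defensive.

Import Order.TTheory GRing.Theory Num.Theory.
Import numFieldNormedType.Exports.

Local Open Scope classical_set_scope.
Local Open Scope ring_scope.

(** Why the theorem holds.  Write a' > a >= b > b' > -1 with
    a + b = a' + b' = sigma.  The heart of the matter is the case n = 2, where
    q = (a', b') and p = (a, b).  The product R_a(x) R_b(x) is a double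
    integral over s, t > 0.  In the coordinates v = s + t and r = s / t
    ([integral_ratio_sum]) it becomes the Laplace transform in v of
      v^(sigma+1) K_ab(v^2) / 2, where
      K_ab(y) = int_0^oo (r^a + r^b) (1+r)^-(sigma+2) exp (- y spread(r) / 2) dr
    and spread(r) = (1 + r^2) / (1 + r)^2.  The factor r^a + r^b symmetrizes
    the two exponents.  Dropping the Gaussian factor and taking x = 1 turns the
    same formula into
      2 Gamma(a+1) Gamma(b+1) = Gamma(sigma+2) K_ab(0).
    Every Laplace transform of a nonnegative density is completely monotonic
    ([cm_laplace]), so for n = 2 it suffices to compare K_ab(y) and K_a'b'(y)
    at each y:

    - K_ab(y) < K_a'b'(y), because r^a + r^b is r^(sigma/2) times twice a
      hyperbolic cosine of ((a - b)/2) ln r ([ratio_integral_lt]);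
    - K_ab(y) > c K_a'b'(y) for y > 0, where
      c = K_ab(0) / K_a'b'(0) = Gamma(a+1) Gamma(b+1) / (Gamma(a'+1) Gamma(b'+1)).
      The function r^a + r^b - c (r^a' + r^b') has weighted integral 0, is
      positive for |ln r| < l and negative for |ln r| > l, while
      exp (- y spread(r) / 2) decreases with |ln r|.  This is Chebyshev's
      association inequality ([ratio_integral_gt]).

    For general n, the vector p is reached from q by finitely many transfers
    between two coordinates ([majorized_sandwiched]).  Each transfer is the
    case n = 2 multiplied by the remaining factors, and completely monotonic
    functions are closed under sums and products ([cmD], [cmM]).  The
    differences telescope, which gives complete monotonicity and strict
    positivity of both P_q - P_p and P_p - (G_p / G_q) P_q, where
    P_u = prod_j R_(u_j) and G_u = prod_j Gamma(u_j + 1).  The two thresholds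
    for lambda differ from these cases by a nonnegative multiple of P_q.
    Conversely x^(a+1) R_a(x) tends to Gamma(a+1) as x tends to +oo
    ([laplace_gauss_cvg]); hence P_p / P_q tends to G_p / G_q, no larger
    lambda keeps the difference nonnegative and the lower bound is sharp. *)

(** * Closure properties of completely monotonic functions *)

Section CompletelyMonotonic.
Context {R : realType}.
Local Notation cm := (@completely_monotonic R `]0, +oo[).

Lemma near_pos (x : R) : 0 < x -> \forall y \near x, 0 < y.
Proof. by move=> x0; exact: lt_nbhsr. Qed.

(** A coinduction principle.  If each member of a class is nonnegative and has
    minus its derivative in the class again, then the m-th derivative is
    (-1)^m times a member.  It replaces explicit formulas, such as Leibniz's
    rule, for the higher derivatives. *)
Lemma cm_coind (C : (R -> R) -> Prop) :
  (forall f, C f -> forall x, 0 < x -> 0 <= f x) ->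
  (forall f, C f -> exists2 g, C g &
     forall x : R, 0 < x -> is_derive x 1 f (- g x)) ->
  forall f, C f -> cm f.
Proof.
move=> C0 C1 f Cf.
have iterC m : exists2 g, C g & forall x, 0 < x -> derive1n m f x = (-1) ^+ m * g x.
  elim: m => [|m [g Cg fg]].
    by exists f => // x x0; rewrite expr0 mul1r.
  have [g' Cg' gg'] := C1 _ Cg.
  exists g' => // x x0; rewrite derive1nS derive1E.
  rewrite (@near_eq_derive _ _ _ _ (fun y => (-1) ^+ m * g y)) ?oner_eq0//; last first.
    by near=> y; rewrite fg//; near: y; exact: near_pos.
  have gx := gg' _ x0.
  by rewrite derive_val /= exprS mulN1r mulNr -mulrN.
move=> m x; rewrite in_itv/= andbT => x0.
have [g Cg fg] := iterC m.
have [g' _ gg'] := C1 _ Cg; have gx := gg' _ x0.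
split; last by rewrite fg// mulrA -exprMn mulrNN mulr1 expr1n mul1r; exact: C0.
apply: (@near_eq_derivable _ _ _ (fun y => (-1) ^+ m * g y)) => //.
by near=> y; rewrite fg//; near: y; exact: near_pos.
Unshelve. all: by end_near. Qed.

Lemma cm_ge0 f : cm f -> forall x, 0 < x -> 0 <= f x.
Proof.
move=> cf x x0; have [] := cf 0%N x; first by rewrite in_itv/= x0.
by rewrite /= expr0 mul1r.
Qed.

Lemma cm_cst (c : R) : 0 <= c -> cm (fun=> c).
Proof.
move=> c0.
apply: (@cm_coind (fun f => exists2 k, 0 <= k & f = fun=> k)); last by exists c.
  by move=> f [k k0 ->].
move=> f [k k0 ->]; exists (fun=> 0); first by exists 0.
by move=> x x0; rewrite oppr0; exact: is_derive_cst.
Qed.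

(** The semiring generated by all the functions (-1)^k h^(k) with h completely
    monotonic.  Starting from derivatives makes the class stable under
    f |-> - f' by the product rule alone. *)
Inductive cm_closure : (R -> R) -> Prop :=
| cm_closure_derive (h : R -> R) (k : nat) :
    cm h -> cm_closure (fun x => (-1) ^+ k * derive1n k h x)
| cm_closureD f g : cm_closure f -> cm_closure g ->
    cm_closure (fun x => f x + g x)
| cm_closureM f g : cm_closure f -> cm_closure g ->
    cm_closure (fun x => f x * g x).

Lemma cm_closure_ge0 f : cm_closure f -> forall x, 0 < x -> 0 <= f x.
Proof.
elim=> [h k ch x x0|{}f g _ f0 _ g0 x x0|{}f g _ f0 _ g0 x x0].
- by have [] := ch k x; first by rewrite in_itv/= x0.
- by apply: addr_ge0; [exact: f0|exact: g0].
- by apply: mulr_ge0; [exact: f0|exact: g0].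
Qed.

Lemma cm_closure_step f : cm_closure f ->
  exists2 g, cm_closure g & forall x : R, 0 < x -> is_derive x 1 f (- g x).
Proof.
elim=> [h k ch|{}f g Cf [f' Cf' ff'] Cg [g' Cg' gg']
             |{}f g Cf [f' Cf' ff'] Cg [g' Cg' gg']].
- exists (fun x => (-1) ^+ k.+1 * derive1n k.+1 h x).
    exact: cm_closure_derive.
  move=> x x0; have [] := ch k x; first by rewrite in_itv/= x0.
  move=> dh _; rewrite exprS mulN1r mulNr opprK derive1nS derive1E.
  have dh' : is_derive x 1 (derive1n k h) ('D_1 (derive1n k h) x).
    exact: derivableP.
  exact: (is_deriveZ ((-1) ^+ k)).
- exists (fun x => f' x + g' x); first exact: cm_closureD.
  move=> x x0; rewrite opprD.
  exact: is_deriveD (ff' _ x0) (gg' _ x0).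
- exists (fun x => f x * g' x + g x * f' x).
    by apply: cm_closureD; apply: cm_closureM.
  move=> x x0; rewrite opprD -!mulrN.
  exact: is_deriveM (ff' _ x0) (gg' _ x0).
Qed.

Lemma cm_closure_cm f : cm_closure f -> cm f.
Proof. exact: cm_coind cm_closure_ge0 cm_closure_step _. Qed.

Lemma cm_in_closure f : cm f -> cm_closure f.
Proof.
move=> cf; have := cm_closure_derive 0 cf.
by under eq_fun do rewrite expr0 mul1r.
Qed.

Lemma cmD f g : cm f -> cm g -> cm (fun x => f x + g x).
Proof.
by move=> cf cg; apply/cm_closure_cm/cm_closureD; exact: cm_in_closure.
Qed.

Lemma cmM f g : cm f -> cm g -> cm (fun x => f x * g x).
Proof.
by move=> cf cg; apply/cm_closure_cm/cm_closureM; exact: cm_in_closure.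
Qed.

Lemma cmZ (c : R) f : 0 <= c -> cm f -> cm (fun x => c * f x).
Proof. by move=> c0; apply: cmM; exact: cm_cst. Qed.

Lemma cm_prod (I : Type) (s : seq I) (P : pred I) (f : I -> R -> R) :
  (forall i, P i -> cm (f i)) -> cm (fun x => \prod_(i <- s | P i) f i x).
Proof.
move=> cf; elim: s => [|i s IH].
  rewrite (_ : (fun _ => _) = fun=> 1); first exact: cm_cst.
  by apply/funext => x; rewrite big_nil.
rewrite (_ : (fun _ => _) =
  if P i then (fun x => f i x * \prod_(j <- s | P j) f j x)
  else (fun x => \prod_(j <- s | P j) f j x)).
  by case: ifPn => // Pi; apply: cmM => //; exact: cf.
by apply/funext => x; rewrite big_cons; case: ifP.
Qed.

(** Derivatives at x > 0 only see the values near x, hence only those on the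
    half-line. *)
Lemma eq_cm f g : (forall x, 0 < x -> f x = g x) -> cm f -> cm g.
Proof.
move=> fg cf.
apply: (@cm_coind (fun h => exists2 h', cm_closure h' &
    forall x, 0 < x -> h' x = h x)).
- by move=> h [h' ch' hh'] x x0; rewrite -hh'//; exact: cm_closure_ge0.
- move=> h [h' ch' hh'].
  have [k ck h'k] := cm_closure_step ch'.
  exists k; first by exists k.
  move=> x x0; apply: near_eq_is_derive (h'k _ x0).
  by near=> y; apply: hh'; near: y; exact: near_pos.
- by exists f => //; exact: cm_in_closure.
Unshelve. all: by end_near. Qed.

End CompletelyMonotonic.

(** * Change of variables on the half-line *)

Lemma measurable_inv {R : realType} :
  measurable_fun [set: R] (@GRing.inv R).
Proof.
(* [powR _ (-1)] is the inverse on nonnegative arguments only, whence the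
   square. *)
have -> : (@GRing.inv R) = (fun x => x * (x ^+ 2) `^ (-1))%R.
  apply/funext => x; rewrite powR_inv1 ?sqr_ge0//.
  have [->|x0] := eqVneq x 0%R; first by rewrite mul0r invr0.
  by rewrite expr2 invfM mulrA divff// mul1r.
apply: measurable_funM => //.
exact: (measurableT_comp (@measurable_powR _ _)).
Qed.

(** The last branches catch functions that the unifier has eta-reduced. *)
Ltac prove_measurable := lazymatch goal with
  | |- measurable_fun _ (fun x => (@?f x + @?g x)%R) =>
      apply: measurable_funD; prove_measurable
  | |- measurable_fun _ (fun x => (- @?f x)%R) =>
      apply: measurable_funN; prove_measurable
  | |- measurable_fun _ (fun x => (@?f x * @?g x)%R) =>
      apply: measurable_funM; prove_measurable
  | |- measurable_fun _ (fun x => (@?f x ^+ _)%R) =>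
      apply: measurable_funX; prove_measurable
  | |- measurable_fun _ (fun x => ((@?f x)^-1)%R) =>
      apply: (measurableT_comp measurable_inv (g := f)); prove_measurable
  | |- measurable_fun _ (fun x => (@?f x `^ ?p)%R) =>
      apply: (measurableT_comp (measurable_powR p) (g := f)); prove_measurable
  | |- measurable_fun _ (fun x => expR (@?f x)) =>
      apply: (measurableT_comp (@measurable_expR _) (g := f)); prove_measurable
  | |- measurable_fun _ (fun x => ln (@?f x)) =>
      apply: (measurableT_comp (@measurable_ln _) (g := f)); prove_measurable
  | |- measurable_fun _ ( *%R ?k) => exact: mulrl_measurable
  | |- measurable_fun _ ( +%R ?k) =>
      apply: (@measurable_funD _ _ _ _ (fun=> k) id); prove_measurable
  | _ => first [ assumption | exact: measurable_cst | exact: measurable_id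
      | exact: measurable_fst | exact: measurable_snd | exact: measurable_powR
      | exact: measurable_expR
      | exact: measurable_ln | exact: measurable_inv ]
  end.

Section HalfLineIntegrals.
Context {R : realType}.
Local Notation measurable2 f := (measurable_fun setT
  (fun z : measurableTypeR R * measurableTypeR R => f z.1 z.2)).
Local Open Scope ereal_scope.
Local Notation mu := (@lebesgue_measure R).
Local Notation D := (`]0%R, +oo[%classic : set (measurableTypeR R)).

Lemma lebesgue_measure_scale (k : R) (A : set (measurableTypeR R)) :
  (0 < k)%R -> measurable A ->
  k%:E * pushforward mu (fun x => k * x : measurableTypeR R)%R A = mu A.
Proof.
move=> k0 mA.
have mk : measurable_fun setT
    ((fun x => k * x)%R : measurableTypeR R -> measurableTypeR R).
  exact: mulrl_measurable.
pose nu := mscale (NngNum (ltW k0)) (pushforward mu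
   ((fun x => k * x)%R : measurableTypeR R -> measurableTypeR R)).
apply/esym; change (mu A = nu mk A).
apply: lebesgue_measure_unique => //= _ [[a b]] /= _ <-.
rewrite /nu /mscale /= /pushforward.
rewrite (_ : _ @^-1` _ = `](a / k)%R, (b / k)%R]%classic); last first.
  apply/seteqP; split => x /=; rewrite !in_itv/= ltr_pdivrMr// ler_pdivlMr//;
    by rewrite [(k * x)%R]mulrC.
rewrite !lebesgue_measure_itv/= !lte_fin ltr_pM2r ?invr_gt0//.
case: ifP => ab; last by rewrite mule0.
by rewrite -EFinM; congr EFin; rewrite -mulrBl mulrC divfK ?gt_eqF.
Qed.

Lemma half_line_integral_scale (k : R) (f : R -> R) : (0 < k)%R ->
  measurable_fun setT f -> (forall x, 0 < x -> 0 <= f x)%R ->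
  \int[mu]_(t in D) (f t)%:E = k%:E * \int[mu]_(t in D) (f (k * t)%R)%:E.
Proof.
move=> k0 mf f0.
have mk : measurable_fun setT
    ((fun x => k * x)%R : measurableTypeR R -> measurableTypeR R).
  exact: mulrl_measurable.
have mEf : measurable_fun D (EFin \o f).
  by apply: measurable_funTS; exact/measurable_EFinP.
have Ef0 x : D x -> 0 <= (f x)%:E.
  by rewrite /= in_itv/= andbT => x0; rewrite lee_fin f0.
pose nu := mscale (NngNum (ltW k0)) (pushforward mu
   ((fun x => k * x)%R : measurableTypeR R -> measurableTypeR R)).
transitivity (\int[nu mk]_(t in D) (f t)%:E).
  by apply: eq_measure_integral => //= A mA _; rewrite -(lebesgue_measure_scale k0).
rewrite ge0_integral_mscale//.
rewrite /= ge0_integral_pushforward//; last by move=> x /set_mem; exact: Ef0.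
rewrite (_ : _ @^-1` _ = D)//.
by apply/seteqP; split => x /=; rewrite !in_itv/= !andbT pmulr_rgt0.
Qed.

Lemma half_line_tonelli (f : R -> R -> R) :
  measurable2 f ->
  (forall s t, 0 < s -> 0 < t -> 0 <= f s t)%R ->
  \int[mu]_(s in D) \int[mu]_(t in D) (f s t)%:E =
  \int[mu]_(t in D) \int[mu]_(s in D) (f s t)%:E.
Proof.
move=> mf f0.
pose g := (fun z : R * R => (f z.1 z.2)%:E) \_ (D `*` D).
have mg : measurable_fun setT g.
  apply/(measurable_restrictT _ _).1; first exact: measurableX.
  by apply: measurable_funTS; exact/measurable_EFinP.
have g0 z : 0 <= g z.
  rewrite /g patchE; case: ifPn => //.
  by rewrite inE => -[/=]; rewrite !in_itv/= !andbT => s0 t0; rewrite lee_fin f0.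
have := @fubini_tonelli _ _ _ _ _ mu mu g mg g0.
have E1 s : \int[mu]_t g (s, t) = ((fun s => \int[mu]_(t in D) (f s t)%:E) \_ D) s.
  rewrite /g patchE; case: ifPn => sD.
    rewrite [RHS]integral_mkcond; apply: eq_integral => t _.
    by rewrite !patchE in_setX sD.
  by rewrite integral0_eq// => t _; rewrite patchE in_setX (negbTE sD).
have E2 t : \int[mu]_s g (s, t) = ((fun t => \int[mu]_(s in D) (f s t)%:E) \_ D) t.
  rewrite /g patchE; case: ifPn => sD.
    rewrite [RHS]integral_mkcond; apply: eq_integral => s _.
    by rewrite !patchE in_setX sD andbT.
  by rewrite integral0_eq// => s _; rewrite patchE in_setX (negbTE sD) andbF.
under eq_integral do rewrite E1.
under [RHS]eq_integral do rewrite E2.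
by rewrite -!integral_mkcond.
Qed.

Lemma measurable_integral_param (f : R -> R -> R) :
  measurable2 f ->
  (forall s t, 0 < t -> 0 <= f s t)%R ->
  measurable_fun setT (fun s : measurableTypeR R => \int[mu]_(t in D) (f s t)%:E).
Proof.
move=> mf f0.
pose g := (fun z : R * R => (f z.1 z.2)%:E) \_ (setT `*` D).
have mg : measurable_fun setT g.
  apply/(measurable_restrictT _ _).1; first exact: measurableX.
  by apply: measurable_funTS; exact/measurable_EFinP.
have g0 z : 0 <= g z.
  rewrite /g patchE; case: ifPn => //.
  by rewrite inE => -[/=]; rewrite in_itv/= !andbT => _ t0; rewrite lee_fin f0.
have := @measurable_fun_fubini_tonelli_F _ _ _ _ _ mu g mg g0.
rewrite /fubini_F; apply: eq_measurable_fun => s _.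
rewrite [RHS]integral_mkcond; apply: eq_integral => t _.
by rewrite /g !patchE in_setX in_setT.
Qed.

Lemma measurable_curry_comp (g : R -> R -> R) d (T : measurableType d) (u v : T -> R) :
  measurable2 g ->
  measurable_fun setT u -> measurable_fun setT v ->
  measurable_fun setT (fun x => g (u x) (v x)).
Proof.
move=> mg mu_ mv.
exact: (measurableT_comp mg (measurable_fun_pair mu_ mv)).
Qed.

Lemma half_line_gt0 (x : R) : x \in (`]0%R, +oo[%classic : set R) -> (0 < x)%R.
Proof. by rewrite inE/= in_itv/= andbT. Qed.

(** The substitution s = r v / (1 + r), t = v / (1 + r), with Jacobian
    v / (1 + r)^2.  Tonelli's theorem reduces it to two dilations: s = r t for
    fixed t, then t = v / (1 + r) for fixed r. *)
Lemma integral_ratio_sum (g : R -> R -> R) :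
  measurable2 g ->
  (forall s t, 0 < s -> 0 < t -> 0 <= g s t)%R ->
  \int[mu]_(s in D) \int[mu]_(t in D) (g s t)%:E =
  \int[mu]_(v in D) \int[mu]_(r in D)
     (v / (1 + r) ^+ 2 * g (r * v / (1 + r)) (v / (1 + r)))%:E.
Proof.
move=> mg g0.
have mD : measurable (D : set (measurableTypeR R)) by exact: measurable_itv.
have mcomp := measurable_curry_comp mg.
rewrite (half_line_tonelli mg g0).
transitivity (\int[mu]_(t in D) \int[mu]_(r in D) (t * g (r * t) t)%:E).
  apply: eq_integral => t /half_line_gt0 t0.
  rewrite (half_line_integral_scale t0); last 2 first.
  - by apply: mcomp; prove_measurable.
  - by move=> s s0; exact: g0.
  rewrite -ge0_integralZl//; last 3 first.
  - by apply/measurable_EFinP/measurable_funTS/mcomp; prove_measurable.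
  - by move=> r /=; rewrite in_itv/= andbT => r0; rewrite lee_fin g0// mulr_gt0.
  - by rewrite lee_fin ltW.
  by apply: eq_integral => r _; rewrite EFinM [(r * t)%R]mulrC.
rewrite (@half_line_tonelli (fun t r => t * g (r * t) t)%R); last 2 first.
- by apply: measurable_funM => //; apply: mcomp; prove_measurable.
- by move=> t r t0 r0; apply: mulr_ge0; [exact: ltW|rewrite g0// mulr_gt0].
rewrite [RHS](@half_line_tonelli (fun v r => v / (1 + r) ^+ 2 *
  g (r * v / (1 + r)) (v / (1 + r)))%R); last 2 first.
- by apply: measurable_funM; [|apply: mcomp]; prove_measurable.
- move=> v r v0 r0; have r1 : (0 < 1 + r)%R by rewrite addr_gt0.
  by rewrite mulr_ge0 ?divr_ge0 ?sqr_ge0 ?g0 ?divr_gt0 ?mulr_gt0 ?ltW.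
apply: eq_integral => r /half_line_gt0 r0.
have r1 : (0 < 1 + r)%R by rewrite addr_gt0.
have r1' : (0 < (1 + r)^-1)%R by rewrite invr_gt0.
rewrite (half_line_integral_scale r1'); last 2 first.
- by apply: measurable_funM => //; apply: mcomp; prove_measurable.
- by move=> t t0; apply: mulr_ge0; [exact: ltW|rewrite g0// mulr_gt0].
rewrite -ge0_integralZl//; last 3 first.
- apply/measurable_EFinP/measurable_funTS.
  by apply: measurable_funM; [|apply: mcomp]; prove_measurable.
- move=> t /=; rewrite in_itv/= andbT => t0; rewrite lee_fin.
  by rewrite mulr_ge0 ?g0 ?mulr_gt0// mulr_ge0// ltW.
- by rewrite lee_fin ltW.
apply: eq_integral => t _; rewrite -EFinM; congr EFin.
rewrite [((1 + r)^-1 * t)%R]mulrC [(r * (t / _))%R]mulrA mulrA; congr (_ * _)%R.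
by rewrite expr2 invfM; ring.
Qed.
End HalfLineIntegrals.

(** * Convergence of the Gamma integral *)

Section GammaIntegral.
Context {R : realType}.
Local Notation mu := (@lebesgue_measure R).
Local Notation D := (`]0%R, +oo[%classic : set (measurableTypeR R)).

(* With p = a + 1, F p t is (t / (1 + t))^p / p, an antiderivative bounded
   by 1 / p of f p t = t^a / (1 + t)^(a+2). *)
Let w (t : R) := ln t - ln (1 + t).
Let F (p t : R) := p^-1 * expR (p * w t).
Let f (p t : R) := expR (p * w t) * (t^-1 - (1 + t)^-1).

Let is_derive_w (t : R) : 0 < t -> is_derive t 1 w (t^-1 - (1 + t)^-1).
Proof.
move=> t0.
have h1 : is_derive t 1 (fun t : R => 1 + t) (0 + 1).
  exact: is_deriveD.
have h2 := is_derive1_ln (addr_gt0 ltr01 t0).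
have h3 : is_derive t 1 (@ln R \o (fun t : R => 1 + t)) ((1 + t)^-1 * (0 + 1)).
  exact: is_derive1_comp.
rewrite add0r mulr1 in h3.
by apply: is_deriveB; exact: is_derive1_ln.
Qed.

Let is_derive_expRw (p t : R) : 0 < t ->
  is_derive t 1 (fun t => expR (p * w t)) (p * f p t).
Proof.
move=> t0.
have h1 := is_deriveZ p (is_derive_w t0).
have h2 := @is_derive1_comp _ expR (fun t => p * w t) t _ _ (is_derive_expR _) h1.
by rewrite /f mulrCA; exact: h2.
Qed.

Let is_derive_F (p t : R) : 0 < p -> 0 < t -> is_derive t 1 (F p) (f p t).
Proof.
move=> p0 t0.
have := is_deriveZ p^-1 (is_derive_expRw p t0).
by rewrite scalerA mulVf ?gt_eqF// scale1r.
Qed.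

Let derivable_f (p t : R) : 0 < t -> derivable (f p) t 1.
Proof.
move=> t0; apply: derivableM.
  by have [] := is_derive_expRw p t0.
apply: derivableB; apply: derivableV; rewrite ?gt_eqF//.
by rewrite addr_gt0.
Qed.

Let f_ge0 (p t : R) : 0 < t -> 0 <= f p t.
Proof.
move=> t0; rewrite mulr_ge0 ?expR_ge0// subr_ge0 lef_pV2 ?posrE ?addr_gt0//.
by rewrite lerDr.
Qed.

Let integral_f_itv (p a b : R) : 0 < p -> 0 < a -> a < b ->
  (\int[mu]_(t in `[a, b]) (f p t)%:E <= p^-1%:E)%E.
Proof.
move=> p0 a0 ab.
have posab t : t \in `[a, b] -> 0 < t.
  by rewrite in_itv/= => /andP[at_ _]; exact: lt_le_trans at_.
have dF (t : R) : 0 < t -> derivable (F p) t 1.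
  by move=> t0; have [] := is_derive_F p0 t0.
have cF (t : R) : 0 < t -> F p x @[x --> t] --> F p t.
  by move=> t0; apply/differentiable_continuous; rewrite -derivable1_diffP; exact: dF.
rewrite (@continuous_FTC2 _ (f p) (F p))//.
- rewrite -EFinD lee_fin /F.
  rewrite (@le_trans _ _ (p^-1 * expR (p * w b)))//.
    by rewrite gerDl oppr_le0 mulr_ge0 ?expR_ge0// invr_ge0 ltW.
  rewrite ler_piMr ?invr_ge0 ?(ltW p0)//.
  rewrite -expR0 ler_expR mulr_ge0_le0 ?(ltW p0)// /w subr_le0.
  have b0 := lt_trans a0 ab.
  by rewrite ler_ln ?posrE ?addr_gt0// lerDr.
- by apply: derivable_within_continuous => t /posab; exact: derivable_f.
- split.
  + by move=> t; move/subset_itv_oo_cc/posab; exact: dF.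
  + by apply: cvg_at_right_filter; exact: cF.
  + by apply: cvg_at_left_filter; apply: cF; exact: lt_trans ab.
- move=> t; move/subset_itv_oo_cc/posab => t0.
  by rewrite derive1E; have [_ ->] := is_derive_F p0 t0.
Qed.

Let measurable_f (p : R) : measurable_fun setT (f p).
Proof.
by rewrite /f /w; prove_measurable.
Qed.

Let integral_f (p : R) : 0 < p -> (\int[mu]_(t in D) (f p t)%:E <= p^-1%:E)%E.
Proof.
move=> p0.
pose I (n : nat) : set (measurableTypeR R) := `[(n.+2%:R)^-1, n.+2%:R]%classic.
have -> : D = \bigcup_n I n.
  apply/seteqP; split => t /=.
    rewrite in_itv/= andbT => t0.
    exists (Num.bound (t + t^-1)) => //; rewrite /I/= in_itv/=.
    have : t + t^-1 < (Num.bound (t + t^-1))%:R.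
      by apply: archi_boundP; rewrite addr_ge0 ?invr_ge0// ltW.
    set N := Num.bound _ => tN.
    have t'0 : 0 < t^-1 by rewrite invr_gt0.
    have N2 : N%:R <= N.+2%:R :> R by rewrite ler_nat -addn2 leq_addr.
    apply/andP; split; last by lra.
    by rewrite invf_ple ?posrE//; lra.
  move=> [n _]; rewrite /I/= !in_itv/= andbT => /andP[+ _].
  by apply: lt_le_trans; rewrite invr_gt0.
have h : (\int[mu]_(t in I i) (f p t)%:E @[i --> \oo] -->
    \int[mu]_(t in \bigcup_i I i) (f p t)%:E)%E.
  apply: ge0_nondecreasing_set_cvg_integral.
  - apply/nondecreasing_seqP => n; rewrite subsetEset => t /=.
    rewrite /I/= !in_itv/= => /andP[h1 h2]; apply/andP; split.
      by apply: le_trans h1; rewrite lef_pV2 ?posrE// ler_nat.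
    by apply: (le_trans h2); rewrite ler_nat.
  - by move=> n; exact: measurable_itv.
  - by move=> n; apply/measurable_funTS/measurable_EFinP; exact: measurable_f.
  - move=> n t; rewrite /I/= in_itv/= => /andP[nt _].
    by rewrite lee_fin f_ge0// (lt_le_trans _ nt)// invr_gt0.
rewrite -(cvg_lim _ h)//.
apply: lime_le; first by apply/cvg_ex; eexists; exact: h.
apply: nearW => n; apply: integral_f_itv => //.
by rewrite (@lt_trans _ _ 1)// ?invf_lt1// ltr1n.
Qed.

(** The singularity at 0 and the tail are handled together: t^a e^-t is at most
    a constant times t^a (1 + t)^-(a+2), whose integral is 1 / (a + 1). *)
Lemma gamma_integral_lty (a : R) : -1 < a ->
  (\int[mu]_(t in D) (t `^ a * expR (- t))%:E < +oo)%E.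
Proof.
move=> a1; pose p := a + 1; have p0 : 0 < p by rewrite /p; lra.
pose q := p + 1; have q0 : 0 < q by rewrite addr_gt0.
have fle : forall t, 0 < t -> t `^ a * expR (- t) <= (q `^ q * expR 1) * f p t.
  move=> t t0; have t1 : 0 < 1 + t by rewrite addr_gt0.
  have ft : f p t = t `^ a * (1 + t) `^ (- q).
    rewrite /f /w /powR !gt_eqF//.
    have -> : t^-1 - (1 + t)^-1 = t^-1 * (1 + t)^-1.
      by field; rewrite !gt_eqF.
    have -> : t^-1 = expR (- ln t) by rewrite expRN lnK.
    have -> : (1 + t)^-1 = expR (- ln (1 + t)) by rewrite expRN lnK.
    rewrite -!expRD; congr expR.
    by rewrite /q /p; ring.
  rewrite ft mulrCA ler_wpM2l ?powR_ge0//.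
  rewrite powRN ler_pdivlMr ?powR_gt0// expRN mulrC ler_pdivrMr ?expR_gt0//.
  rewrite -mulrA -expRD /powR !gt_eqF// -expRD ler_expR.
  (* (1 + t)^q <= q^q e^(1+t) is the logarithm bound at (1 + t) / q. *)
  have := ln_sublinear (divr_gt0 t1 q0).
  rewrite ln_div ?posrE// ltrBlDr -(ltr_pM2l q0) mulrDr mulrCA divff ?gt_eqF//.
  rewrite mulr1 => h.
  by rewrite (le_trans (ltW h))// addrC.
apply: (@le_lt_trans _ _ (\int[mu]_(t in D) ((q `^ q * expR 1) * f p t)%:E)%E).
  apply: ge0_le_integral => //.
  - by move=> t /= t0; rewrite lee_fin mulr_ge0 ?powR_ge0 ?expR_ge0.
  - by apply/measurable_EFinP/measurable_funTS; prove_measurable.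
  - apply/measurable_EFinP/measurable_funTS/measurable_funM => //.
    exact: measurable_f.
  - by move=> t /=; rewrite in_itv/= andbT => t0; rewrite lee_fin fle.
under eq_integral do rewrite EFinM.
have C0 : 0 <= q `^ q * expR 1 by rewrite mulr_ge0 ?powR_ge0 ?expR_ge0.
rewrite ge0_integralZl//.
- rewrite lte_mul_pinfty// ?lee_fin//.
  by apply: le_lt_trans (integral_f p0) _; exact: ltry.
- by apply/measurable_EFinP/measurable_funTS; exact: measurable_f.
- by move=> t /=; rewrite in_itv/= andbT => t0; rewrite lee_fin f_ge0.
Qed.
End GammaIntegral.

(** * Laplace transforms of nonnegative densities *)

Section LaplaceTransform.
Context {R : realType}.
Local Notation mu := (@lebesgue_measure R).
Local Notation D := (`]0%R, +oo[%classic : set (measurableTypeR R)).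
Local Notation cm := (@completely_monotonic R `]0, +oo[).

Lemma Rintegral_gt0 (f : R -> R) (a b : R) : 0 <= a -> a < b ->
  mu.-integrable D (EFin \o f) ->
  (forall t, 0 < t -> 0 <= f t) -> (forall t, a < t < b -> 0 < f t) ->
  0 < \int[mu]_(t in D) f t.
Proof.
move=> a0 ab intf f0 f1.
have f0' t : D t -> 0 <= f t by rewrite /= in_itv/= andbT; exact: f0.
rewrite lt_neqAle Rintegral_ge0 ?andbT; last by move=> t /f0'.
apply/negP => /eqP intf0.
have mD : measurable D by exact: measurable_itv.
have mf : measurable_fun D (EFin \o f) by case/integrableP: intf.
have : (\int[mu]_(t in D) `| (EFin \o f) t | = 0)%E.
  rewrite -[RHS]/(0%:E) [X in _ = X%:E]intf0 fineK; last exact: integrable_fin_num.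
  by apply: eq_integral => t /set_mem/f0' ft; rewrite /= ger0_norm.
move/(ae_eq_integral_abs mu mD mf) => [N [mN N0 Nf]].
have abN : `]a, b[%classic `<=` N.
  move=> t /= tab; apply: Nf => /= h.
  rewrite in_itv/= in tab.
  have := h; rewrite in_itv/= andbT => /(_ _)/= h'.
  have t0 : 0 < t by case/andP: tab => at_ _; exact: le_lt_trans at_.
  have [ft0] := h' t0.
  by have := f1 t tab; rewrite ft0 ltxx.
have : (mu `]a, b[%classic <= mu N)%E.
  by apply: le_measure; rewrite ?inE.
rewrite [leRHS]N0 lebesgue_measure_itv/= lte_fin ab -EFinD lee_fin.
by rewrite leNgt subr_gt0 ab.
Qed.

Definition laplace (f : R -> R) (x : R) : R :=
  \int[mu]_(t in D) (f t * expR (- (x * t))).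

Definition laplace_density (f : R -> R) : Prop :=
  [/\ measurable_fun setT f, forall t, 0 < t -> 0 <= f t &
      forall x, 0 < x -> (\int[mu]_(t in D) (f t * expR (- (x * t)))%:E < +oo)%E].

Lemma laplace_integrable f x : laplace_density f -> 0 < x ->
  mu.-integrable D (EFin \o (fun t => f t * expR (- (x * t)))).
Proof.
move=> [mf f0 intf] x0; apply/integrableP; split.
  by apply/measurable_EFinP/measurable_funTS; prove_measurable.
apply: le_lt_trans (intf _ x0).
rewrite le_eqVlt; apply/orP; left; apply/eqP.
apply: eq_integral => t /half_line_gt0 t0.
by rewrite /= ger0_norm// mulr_ge0 ?expR_ge0 ?f0.
Qed.

(** Finiteness survives multiplication by t because
    t e^(-x t) <= (2 / x) e^(-(x / 2) t). *)
Lemma laplace_densityM f : laplace_density f ->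
  laplace_density (fun t => t * f t).
Proof.
move=> df; have [mf f0 intf] := df; split.
- by apply: measurable_funM.
- by move=> t t0; rewrite mulr_ge0 ?f0// ltW.
move=> x x0; have x2 : 0 < x / 2 by rewrite divr_gt0.
apply: (@le_lt_trans _ _
  (\int[mu]_(t in D) ((x / 2)^-1 * (f t * expR (- (x / 2 * t))))%:E)%E); last first.
  under eq_integral do rewrite EFinM.
  rewrite ge0_integralZl//.
  - by rewrite lte_mul_pinfty ?lee_fin ?invr_ge0 ?(ltW x2)//; exact: intf.
  - by apply/measurable_EFinP/measurable_funTS; prove_measurable.
  - move=> t /=; rewrite in_itv/= andbT => t0.
    by rewrite lee_fin mulr_ge0 ?expR_ge0 ?f0.
  - by rewrite lee_fin invr_ge0 ltW.
apply: ge0_le_integral => //.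
- move=> t /=; rewrite in_itv/= andbT => t0.
  by rewrite lee_fin !mulr_ge0 ?expR_ge0 ?f0// ltW.
- by apply/measurable_EFinP/measurable_funTS; prove_measurable.
- by apply/measurable_EFinP/measurable_funTS; prove_measurable.
move=> t /=; rewrite in_itv/= andbT => t0; rewrite lee_fin.
rewrite ler_pdivlMl//.
have -> : x / 2 * (t * f t * expR (- (x * t))) =
  f t * (x / 2 * t * expR (- (x * t))) by ring.
rewrite ler_wpM2l ?f0//.
have -> : - (x * t) = - (x / 2 * t) - x / 2 * t by field.
rewrite expRD mulrCA ler_piMr ?expR_ge0// expRN -ler_pdivlMr ?invr_gt0 ?expR_gt0//.
rewrite div1r invrK (le_trans _ (expR_ge1Dx _))// lerDr//.
Qed.

(** Differentiation under the integral sign on ]x/2, x+1[, where the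
    derivatives are dominated by t f(t) e^(-(x/2) t). *)
Lemma is_derive_laplace f (x : R) : laplace_density f -> 0 < x ->
  is_derive x 1 (laplace f) (- laplace (fun t => t * f t) x).
Proof.
move=> df x0; have [mf f0 intf] := df; have dtf := laplace_densityM df.
have x2 : 0 < x / 2 by rewrite divr_gt0.
have mD : measurable D by exact: measurable_itv.
pose F x t := f t * expR (- (x * t)).
pose G t := t * f t * expR (- (x / 2 * t)).
have dF (y t : R) : is_derive y 1 (F ^~ t) (- (t * f t * expR (- (y * t)))).
  have h1 : is_derive y 1 (fun y : R => - (y * t)) (- t * 1).
    rewrite (_ : (fun y => _) = (fun y => - t * y)).
      exact: (is_deriveZ (- t)).
    by apply/funext => z; rewrite mulNr mulrC.
  have h2 := @is_derive1_comp _ expR (fun y => - (y * t)) y _ _ (is_derive_expR _) h1.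
  have := is_deriveZ (f t) h2.
  rewrite (_ : _ *: _ = - (t * f t * expR (- (y * t))))//.
  by rewrite /GRing.scale/=; ring.
have dFE y t : partial1of2 F y t = - (t * f t * expR (- (y * t))).
  by rewrite partial1of2E; have [_ ->] := dF y t.
have Ix : `]x / 2, x + 1[%classic x by rewrite /= in_itv/=; apply/andP; split; lra.
have Ipos (y : R) : `]x / 2, x + 1[%classic y -> x / 2 < y.
  by rewrite /= in_itv/= => /andP[].
have intF (y : R) : `]x / 2, x + 1[%classic y -> mu.-integrable D (EFin \o F y).
  by move=> /Ipos y0; apply: laplace_integrable => //; exact: lt_trans y0.
pose G' t := `|G t|.
have intG : mu.-integrable D (EFin \o G').
  exact: integrable_abse (laplace_integrable dtf x2).
have G_ub (y t : R) : `]x / 2, x + 1[%classic y -> D t -> `|partial1of2 F y t| <= G' t.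
  move=> /Ipos y0; rewrite /= in_itv/= andbT => t0.
  have tf0 : 0 <= t * f t by rewrite mulr_ge0 ?f0// ltW.
  rewrite dFE normrN /G' /G !normrM ler_wpM2l ?mulr_ge0//.
  by rewrite !ger0_norm ?expR_ge0// ler_expR lerN2 ler_pM2r// ltW.
have dF' (y t : R) : `]x / 2, x + 1[%classic y -> D t -> derivable (F ^~ t) y 1.
  by move=> _ _; have [] := dF y t.
have G0 t : 0 <= G' t by exact: normr_ge0.
split.
  exact: (derivable_under_integral mD Ix intF dF' G0 intG G_ub).
have := differentiation_under_integral mD Ix intF dF' G0 intG G_ub.
rewrite derive1E => ->.
under eq_Rintegral do rewrite dFE -mulN1r.
by rewrite RintegralZl ?mulN1r//; exact: laplace_integrable.
Qed.

Lemma cm_laplace f : laplace_density f -> cm (laplace f).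
Proof.
move=> df; apply: (@cm_coind _ (fun h => exists2 g, laplace_density g & h = laplace g)).
- move=> _ [g [mg g0 _] ->] x x0; apply: Rintegral_ge0 => t /=.
  by rewrite in_itv/= andbT => t0; rewrite mulr_ge0 ?expR_ge0 ?g0.
- move=> _ [g dg ->]; exists (laplace (fun t => t * g t)).
    by exists (fun t => t * g t) => //; exact: laplace_densityM.
  by move=> x x0; exact: is_derive_laplace.
- by exists f.
Qed.

Lemma laplace_gt0 f x : laplace_density f -> (forall t, 0 < t -> 0 < f t) ->
  0 < x -> 0 < laplace f x.
Proof.
move=> df f0 x0; apply: (@Rintegral_gt0 _ 0 1) => //.
- exact: laplace_integrable.
- by move=> t t0; rewrite mulr_ge0 ?expR_ge0// ltW// f0.
- by move=> t /andP[t0 _]; rewrite mulr_gt0 ?expR_gt0 ?f0.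
Qed.

End LaplaceTransform.

(** * Products of two transforms in ratio and sum coordinates *)

Section ProductFormula.
Context {R : realType}.
Local Notation measurable2 f := (measurable_fun setT
  (fun z : measurableTypeR R * measurableTypeR R => f z.1 z.2)).
Local Notation mu := (@lebesgue_measure R).
Local Notation D := (`]0%R, +oo[%classic : set (measurableTypeR R)).

(** The parameter k allows the Gaussian case k = 1, which gives
    [laplace_gauss], and the case k = 0, which gives [Gamma], to be treated
    at once. *)
Definition gaussw (k a t : R) : R := t `^ a * expR (- (k * (t ^+ 2 / 2))).

Lemma gaussw_ge0 k a t : 0 <= gaussw k a t.
Proof. by rewrite mulr_ge0 ?powR_ge0 ?expR_ge0. Qed.

Lemma measurable_gaussw k a : measurable_fun setT (gaussw k a).
Proof. by rewrite /gaussw; prove_measurable. Qed.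

Lemma integral_powR_expR (a x : R) : 0 < x ->
  (\int[mu]_(t in D) (t `^ a * expR (- (x * t)))%:E =
   (x `^ (- (a + 1)))%:E * \int[mu]_(t in D) (t `^ a * expR (- t))%:E)%E.
Proof.
move=> x0; have x'0 : 0 < x^-1 by rewrite invr_gt0.
rewrite (half_line_integral_scale x'0); last 2 first.
- by prove_measurable.
- by move=> t _; rewrite mulr_ge0 ?powR_ge0 ?expR_ge0.
have E t : 0 < t -> (x^-1 * t) `^ a * expR (- (x * (x^-1 * t))) =
    x `^ (- a) * (t `^ a * expR (- t)).
  move=> t0; rewrite mulVKf ?gt_eqF// powRM ?(ltW t0)// ?(ltW x'0)//.
  by rewrite -powR_inv1 ?(ltW x0)// -powRrM mulN1r mulrA.
under eq_integral => t /half_line_gt0 t0 do rewrite (E _ t0) EFinM.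
rewrite ge0_integralZl//.
- rewrite muleA -EFinM; congr (_%:E * _)%E.
  rewrite -powR_inv1 ?(ltW x0)// -powRD; last by apply/implyP => _; rewrite gt_eqF.
  by rewrite opprD addrC.
- by apply/measurable_EFinP/measurable_funTS; prove_measurable.
- by move=> t _; rewrite lee_fin mulr_ge0 ?powR_ge0 ?expR_ge0.
- by rewrite lee_fin powR_ge0.
Qed.

Lemma laplace_density_gaussw (k a : R) : 0 <= k -> -1 < a -> laplace_density (gaussw k a).
Proof.
move=> k0 a1; split => [|t _|x x0]; [exact: measurable_gaussw|exact: gaussw_ge0|].
apply: (@le_lt_trans _ _ (\int[mu]_(t in D) (t `^ a * expR (- (x * t)))%:E)%E).
  apply: ge0_le_integral => //.
  - by move=> t _; rewrite lee_fin mulr_ge0 ?expR_ge0 ?powR_ge0 ?gaussw_ge0.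
  - by apply/measurable_EFinP/measurable_funTS; rewrite /gaussw; prove_measurable.
  - by apply/measurable_EFinP/measurable_funTS; prove_measurable.
  - move=> t _; rewrite lee_fin ler_wpM2r ?expR_ge0//.
    rewrite /gaussw ler_piMr ?powR_ge0// -expR0 ler_expR oppr_le0.
    by rewrite mulr_ge0// divr_ge0// sqr_ge0.
rewrite integral_powR_expR// lte_mul_pinfty ?lee_fin ?powR_ge0//.
exact: gamma_integral_lty.
Qed.

(** (s^2 + t^2) / (s + t)^2 as a function of r = s / t. *)
Definition spread (r : R) : R := (1 + r ^+ 2) / (1 + r) ^+ 2.

(** The weight is symmetrized in a and b: this makes it invariant, up to a
    common factor, under r |-> 1 / r. *)
Definition ratio_weight (a b y r : R) : R :=
  (r `^ a + r `^ b) * (1 + r) `^ (- (a + b + 2)) * expR (- (y * (spread r / 2))).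

Definition ratio_integral (a b y : R) : R :=
  \int[mu]_(r in D) ratio_weight a b y r.

Lemma ratio_weight_ge0 a b y r : 0 <= ratio_weight a b y r.
Proof. by rewrite !mulr_ge0 ?addr_ge0 ?powR_ge0 ?expR_ge0. Qed.

Lemma measurable_ratio_weight a b y : measurable_fun setT (ratio_weight a b y).
Proof. by rewrite /ratio_weight /spread; prove_measurable. Qed.

Lemma EFin_laplace f (x : R) : laplace_density f -> 0 < x ->
  (\int[mu]_(t in D) (f t * expR (- (x * t)))%:E)%E = (laplace f x)%:E.
Proof.
move=> df x0; rewrite /laplace /Rintegral fineK//.
by apply: integrable_fin_num => //; exact: laplace_integrable.
Qed.

Lemma laplace_mul f g (x : R) : laplace_density f -> laplace_density g ->
  0 < x ->
  (\int[mu]_(s in D) \int[mu]_(t in D)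
     (f s * g t * expR (- (x * (s + t))))%:E)%E =
  (laplace f x * laplace g x)%:E.
Proof.
move=> df dg x0; have [mf f0 _] := df; have [mg g0 _] := dg.
transitivity (\int[mu]_(s in D) ((f s * expR (- (x * s)))%:E * (laplace g x)%:E))%E.
  apply: eq_integral => s /half_line_gt0 s0.
  rewrite -EFin_laplace// -ge0_integralZl//.
  - apply: eq_integral => t _; rewrite -EFinM; congr EFin.
    by rewrite mulrDr opprD expRD; ring.
  - by apply/measurable_EFinP/measurable_funTS; prove_measurable.
  - move=> t; rewrite /= in_itv/= andbT => t0.
    by rewrite lee_fin mulr_ge0 ?expR_ge0 ?g0.
  - by rewrite lee_fin mulr_ge0 ?expR_ge0 ?f0.
rewrite ge0_integralZr//.
- by rewrite EFin_laplace.
- by apply/measurable_EFinP/measurable_funTS; prove_measurable.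
- move=> t; rewrite /= in_itv/= andbT => t0.
  by rewrite lee_fin mulr_ge0 ?expR_ge0 ?f0.
- rewrite lee_fin; apply: Rintegral_ge0 => t; rewrite /= in_itv/= andbT => t0.
  by rewrite mulr_ge0 ?expR_ge0 ?g0.
Qed.

(** The product is expanded as a double integral in both orders and then
    written in the coordinates v = s + t and r = s / t, in which s^2 + t^2 is
    v^2 * spread r. *)
Lemma laplace_gaussw_mul (k a b x : R) : 0 <= k -> -1 < a -> -1 < b -> 0 < x ->
  ((2 * (laplace (gaussw k a) x * laplace (gaussw k b) x))%:E =
   \int[mu]_(v in D) ((v `^ (a + b + 1) * expR (- (x * v)))%:E *
     \int[mu]_(r in D) (ratio_weight a b (k * v ^+ 2) r)%:E))%E.
Proof.
move=> k0 a1 b1 x0.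
have da := laplace_density_gaussw k0 a1; have db := laplace_density_gaussw k0 b1.
have mga := measurable_gaussw k a; have mgb := measurable_gaussw k b.
pose g s t :=
  (gaussw k a s * gaussw k b t + gaussw k b s * gaussw k a t) *
  expR (- (x * (s + t))).
have g0 s t : 0 <= g s t.
  by rewrite mulr_ge0 ?expR_ge0// addr_ge0// mulr_ge0// gaussw_ge0.
have mg : measurable2 g.
  by rewrite /g /gaussw; prove_measurable.
transitivity (\int[mu]_(s in D) \int[mu]_(t in D) (g s t)%:E)%E.
  rewrite mulrDl mul1r EFinD -{1}(laplace_mul da db x0).
  rewrite [laplace (gaussw k a) x * _]mulrC -(laplace_mul db da x0).
  rewrite -ge0_integralD//; last 4 first.
  - by move=> s _; apply: integral_ge0 => t _;
       rewrite lee_fin !mulr_ge0 ?expR_ge0 ?powR_ge0 ?gaussw_ge0.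
  - apply: measurable_funTS; apply: measurable_integral_param.
      by rewrite /gaussw; prove_measurable.
    by move=> s t _; rewrite !mulr_ge0 ?expR_ge0 ?powR_ge0 ?gaussw_ge0.
  - by move=> s _; apply: integral_ge0 => t _;
       rewrite lee_fin !mulr_ge0 ?expR_ge0 ?powR_ge0 ?gaussw_ge0.
  - apply: measurable_funTS; apply: measurable_integral_param.
      by rewrite /gaussw; prove_measurable.
    by move=> s t _; rewrite !mulr_ge0 ?expR_ge0 ?powR_ge0 ?gaussw_ge0.
  apply: eq_integral => s _.
  rewrite -ge0_integralD//; last 4 first.
  - by move=> t _; rewrite lee_fin !mulr_ge0 ?expR_ge0 ?powR_ge0 ?gaussw_ge0.
  - by apply/measurable_EFinP/measurable_funTS; prove_measurable.
  - by move=> t _; rewrite lee_fin !mulr_ge0 ?expR_ge0 ?powR_ge0 ?gaussw_ge0.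
  - by apply/measurable_EFinP/measurable_funTS; prove_measurable.
  by apply: eq_integral => t _; rewrite -EFinD -mulrDl.
rewrite integral_ratio_sum//.
apply: eq_integral => v /half_line_gt0 v0.
rewrite -ge0_integralZl; last 4 first.
- exact: measurable_itv.
- by apply/measurable_EFinP/measurable_funTS; exact: measurable_ratio_weight.
- by move=> r _; rewrite lee_fin ratio_weight_ge0.
- by rewrite lee_fin mulr_ge0 ?powR_ge0 ?expR_ge0.
apply: eq_integral => r /half_line_gt0 r0; rewrite -EFinM; congr EFin.
have r1 : 0 < 1 + r by rewrite addr_gt0.
rewrite /g /ratio_weight /gaussw.
set w := v / (1 + r).
have w0 : 0 < w by rewrite divr_gt0.
have vE : v = w * (1 + r) by rewrite /w divfK ?gt_eqF.
have -> : v / (1 + r) ^+ 2 = w / (1 + r) by rewrite expr2 invfM mulrA.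
have -> : r * v / (1 + r) = r * w by rewrite mulrA.
have wab : v `^ (a + b + 1) * (1 + r) `^ (- (a + b + 2)) =
    w `^ a * w `^ b * w / (1 + r).
  rewrite vE powRM ?ltW// -mulrA -powRD; last by apply/implyP => _; rewrite gt_eqF.
  have -> : a + b + 1 - (a + b + 2) = -1 by ring.
  rewrite powR_inv1 ?ltW// powRD; last by apply/implyP => _; rewrite gt_eqF.
  rewrite powRr1 ?ltW// powRD//.
  by apply/implyP => _; rewrite gt_eqF.
have E : expR (- (k * ((r * w) ^+ 2 / 2))) * expR (- (k * (w ^+ 2 / 2))) =
    expR (- (k * v ^+ 2 * (spread r / 2))).
  rewrite -expRD vE /spread; congr expR.
  by field; rewrite gt_eqF.
have -> : r * w + w = v by rewrite vE; ring.
rewrite -E !(powRM _ (ltW r0) (ltW w0)).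
rewrite [RHS](_ : _ = (v `^ (a + b + 1) * (1 + r) `^ (- (a + b + 2))) *
  (expR (- (x * v)) * (r `^ a + r `^ b) *
  (expR (- (k * ((r * w) ^+ 2 / 2))) * expR (- (k * (w ^+ 2 / 2)))))).
  by rewrite wab; ring.
by ring.
Qed.

Lemma integral_powR_expR_gt0 (a : R) : -1 < a ->
  0 < \int[mu]_(t in D) (t `^ a * expR (- t)).
Proof.
move=> a1.
have d := laplace_density_gaussw (lexx 0) a1.
have -> : \int[mu]_(t in D) (t `^ a * expR (- t)) = laplace (gaussw 0 a) 1.
  apply: eq_Rintegral => t _.
  by rewrite /gaussw mul0r oppr0 expR0 mulr1 mul1r.
apply: (@Rintegral_gt0 _ _ 0 1) => //.
- exact: laplace_integrable.
- by move=> t t0; rewrite mulr_ge0 ?expR_ge0 ?gaussw_ge0.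
- by move=> t /andP[t0 _]; rewrite !mulr_gt0 ?powR_gt0 ?expR_gt0.
Qed.

Lemma laplace_gaussw0 (a : R) : laplace (gaussw 0 a) 1 = Gamma (a + 1).
Proof.
apply: eq_Rintegral => t _.
by rewrite /gaussw mul0r oppr0 expR0 mulr1 mul1r addrK.
Qed.

Lemma laplace_gaussw1 (a x : R) : laplace (gaussw 1 a) x = laplace_gauss a x.
Proof. by apply: eq_Rintegral => t _; rewrite /gaussw mul1r. Qed.

Lemma Gamma_gt0 (a : R) : -1 < a -> 0 < Gamma (a + 1).
Proof.
move=> a1; have := integral_powR_expR_gt0 a1.
by rewrite /Gamma addrK.
Qed.

Lemma integral_powR_expR_Gamma (a : R) : -1 < a ->
  (\int[mu]_(t in D) (t `^ a * expR (- t))%:E)%E = (Gamma (a + 1))%:E.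
Proof.
move=> a1.
rewrite -laplace_gaussw0 -(EFin_laplace (laplace_density_gaussw (lexx 0) a1) ltr01).
by apply: eq_integral => t _; rewrite /gaussw mul0r oppr0 expR0 mulr1 mul1r.
Qed.

Lemma spread_ge0 r : 0 <= spread r.
Proof. by rewrite divr_ge0 ?sqr_ge0// addr_ge0// sqr_ge0. Qed.

(** At y = 0 the integral is a factor of a product of two finite Gamma
    integrals, the other factor being positive; larger y only decrease the
    weight. *)
Lemma ratio_integrable (a b y : R) : -1 < a -> -1 < b -> 0 <= y ->
  mu.-integrable D (EFin \o ratio_weight a b y).
Proof.
move=> a1 b1 y0; apply/integrableP; split.
  by apply/measurable_EFinP/measurable_funTS; exact: measurable_ratio_weight.
apply: (@le_lt_trans _ _ (\int[mu]_(r in D) (ratio_weight a b 0 r)%:E)%E).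
  apply: ge0_le_integral => //.
  - apply: measurableT_comp => //.
    by apply/measurable_EFinP/measurable_funTS; exact: measurable_ratio_weight.
  - by apply/measurable_EFinP/measurable_funTS; exact: measurable_ratio_weight.
  move=> r _; rewrite lee_fin ger0_norm ?ratio_weight_ge0//.
  rewrite ler_wpM2l ?mulr_ge0 ?addr_ge0 ?powR_ge0// ler_expR.
  by rewrite mul0r oppr0 oppr_le0 mulr_ge0// divr_ge0// spread_ge0.
have ab1 : -1 < a + b + 1 by lra.
have := laplace_gaussw_mul (lexx 0) a1 b1 ltr01.
under [X in _ = X]eq_integral do rewrite mul0r mul1r.
rewrite ge0_integralZr//; last 3 first.
- by apply/measurable_EFinP/measurable_funTS; prove_measurable.
- by move=> t _; rewrite lee_fin mulr_ge0 ?expR_ge0 ?powR_ge0.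
- by apply: integral_ge0 => r _; rewrite lee_fin ratio_weight_ge0.
rewrite integral_powR_expR_Gamma//.
move: (\int[mu]_(r in D) _)%E => [r|//|//] ; first by rewrite ltry.
by rewrite gt0_muley// lte_fin Gamma_gt0.
Qed.

Lemma EFin_ratio_integral (a b y : R) : -1 < a -> -1 < b -> 0 <= y ->
  (\int[mu]_(r in D) (ratio_weight a b y r)%:E)%E = (ratio_integral a b y)%:E.
Proof.
move=> a1 b1 y0; rewrite /ratio_integral /Rintegral fineK//.
by apply: integrable_fin_num => //; exact: ratio_integrable.
Qed.

(** A symmetrized form of Euler's Beta integral. *)
Lemma Gamma_mul (a b : R) : -1 < a -> -1 < b ->
  2 * (Gamma (a + 1) * Gamma (b + 1)) = Gamma (a + b + 2) * ratio_integral a b 0.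
Proof.
move=> a1 b1.
have ab1 : -1 < a + b + 1 by lra.
have := laplace_gaussw_mul (lexx 0) a1 b1 ltr01.
under [X in _ = X]eq_integral do rewrite mul0r mul1r EFin_ratio_integral//.
rewrite ge0_integralZr//; last 3 first.
- by apply/measurable_EFinP/measurable_funTS; prove_measurable.
- by move=> t _; rewrite lee_fin mulr_ge0 ?expR_ge0 ?powR_ge0.
- by rewrite lee_fin; apply: Rintegral_ge0 => r _; rewrite ratio_weight_ge0.
rewrite integral_powR_expR_Gamma// !laplace_gaussw0 -addrA => -[->].
by congr (Gamma _ * _); rewrite -natrD.
Qed.

Definition ratio_density (a b v : R) : R :=
  v `^ (a + b + 1) * ratio_integral a b (v ^+ 2).

Lemma laplace_gauss_mulE (a b x : R) : -1 < a -> -1 < b -> 0 < x ->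
  (\int[mu]_(v in D) (ratio_density a b v * expR (- (x * v)))%:E)%E =
  (2 * (laplace_gauss a x * laplace_gauss b x))%:E.
Proof.
move=> a1 b1 x0; rewrite -!laplace_gaussw1 laplace_gaussw_mul//.
apply: eq_integral => v _; rewrite mul1r EFin_ratio_integral ?sqr_ge0// -EFinM.
by rewrite /ratio_density mulrAC.
Qed.

Lemma laplace_density_ratio (a b : R) : -1 < a -> -1 < b ->
  laplace_density (ratio_density a b).
Proof.
move=> a1 b1; split.
- rewrite /ratio_density; apply: measurable_funM; first exact: measurable_powR.
  rewrite /ratio_integral /Rintegral.
  apply: (measurableT_comp (fine_measurable _)) => //.
  apply: measurable_integral_param.
    by rewrite /ratio_weight /spread; prove_measurable.
  by move=> s t _; exact: ratio_weight_ge0.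
- move=> t _; rewrite mulr_ge0 ?powR_ge0//; apply: Rintegral_ge0 => r _.
  exact: ratio_weight_ge0.
- by move=> x x0; rewrite laplace_gauss_mulE// ltry.
Qed.

End ProductFormula.

(** * Comparison of the ratio integrals *)

Section Chebyshev.
Context {R : realType}.
Local Notation mu := (@lebesgue_measure R).
Local Notation D := (`]0%R, +oo[%classic : set (measurableTypeR R)).

(** Twice the hyperbolic cosine. *)
Definition ch2 (z : R) : R := expR z + expR (- z).

Lemma ch2_gt0 z : 0 < ch2 z.
Proof. by rewrite addr_gt0 ?expR_gt0. Qed.

Lemma ch2_norm z : ch2 `|z| = ch2 z.
Proof. by case: ger0P => // _; rewrite /ch2 opprK addrC. Qed.

Lemma ch2_lt u v : `|u| < `|v| -> ch2 u < ch2 v.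
Proof.
rewrite -(ch2_norm u) -(ch2_norm v); have := normr_ge0 u.
move: `|u| `|v| => {}u {}v u0 uv; rewrite -subr_gt0.
have -> : ch2 v - ch2 u = (expR v - expR u) * (1 - expR (- u - v)).
  rewrite /ch2 mulrBr mulr1 mulrBl -!expRD.
  have -> : v + (- u - v) = - u by ring.
  have -> : u + (- u - v) = - v by ring.
  by ring.
by rewrite mulr_gt0// subr_gt0 ?ltr_expR// -expR0 ltr_expR; lra.
Qed.

Lemma ch2_le u v : `|u| <= `|v| -> ch2 u <= ch2 v.
Proof.
rewrite le_eqVlt => /predU1P[uv|/ch2_lt/ltW//].
by rewrite -(ch2_norm u) uv ch2_norm.
Qed.

Lemma ch2M u v : ch2 u * ch2 v = ch2 (u + v) + ch2 (u - v).
Proof.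
rewrite /ch2 mulrDl !mulrDr -!expRD !opprD opprK.
by rewrite [- u + v]addrC [- u - v]addrC [v - u]addrC; ring.
Qed.

(** ch2 (al * x) / ch2 (be * x) decreases for x >= 0: by [ch2M] both
    sides are sums of two terms, which are compared one by one. *)
Lemma ch2_ratio (al be x y : R) : 0 <= al -> al < be -> 0 <= x -> x < y ->
  ch2 (al * y) * ch2 (be * x) < ch2 (al * x) * ch2 (be * y).
Proof.
move=> al0 albe x0 xy; rewrite !ch2M.
have h : 0 < (be - al) * (y - x) by rewrite mulr_gt0 ?subr_gt0.
have p1 : 0 <= al * x by rewrite mulr_ge0.
have p2 : 0 <= al * (y - x) by rewrite mulr_ge0// subr_ge0 ltW.
have p3 : 0 <= (be - al) * x by rewrite mulr_ge0// subr_ge0 ltW.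
apply: ler_ltD.
  by apply: ch2_le; rewrite !ger0_norm; nra.
apply: ch2_lt; rewrite [ltRHS]distrC [ltRHS]ger0_norm; last by nra.
by rewrite ltr_norml; apply/andP; split; nra.
Qed.

Lemma powR_add_ch2 (a b r : R) : 0 < r ->
  r `^ a + r `^ b = r `^ ((a + b) / 2) * ch2 ((a - b) / 2 * ln r).
Proof.
move=> r0; rewrite /ch2 /powR !gt_eqF// mulrDr -!expRD.
by congr (expR _ + expR _); field.
Qed.

Lemma spreadE (r : R) : 0 < r -> spread r = 1 - 2 / (2 + ch2 (ln r)).
Proof.
move=> r0; rewrite /spread /ch2 expRN lnK//.
have h1 : 1 + r != 0 by rewrite gt_eqF// addr_gt0.
have h2 : 2 + (r + r^-1) = (1 + r) ^+ 2 / r by field; rewrite gt_eqF.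
by rewrite h2; field; rewrite h1 gt_eqF.
Qed.

Lemma spread_lt (r s : R) : 0 < r -> 0 < s -> `|ln r| < `|ln s| -> spread r < spread s.
Proof.
move=> r0 s0 rs; rewrite !spreadE// ltrD2l ltrN2 ltr_pM2l// ltf_pV2 ?posrE.
- by rewrite ltrD2l ch2_lt.
- by rewrite addr_gt0 ?ch2_gt0.
- by rewrite addr_gt0 ?ch2_gt0.
Qed.

Let mD : measurable D. Proof. exact: measurable_itv. Qed.

Let iZ (k : R) (f : R -> R) : mu.-integrable D (EFin \o f) ->
  mu.-integrable D (EFin \o (fun r => k * f r)).
Proof. by move=> fi; exact: (integrableZl mD k fi). Qed.

Let iB (f g : R -> R) : mu.-integrable D (EFin \o f) ->
  mu.-integrable D (EFin \o g) -> mu.-integrable D (EFin \o (fun r => f r - g r)).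
Proof. by move=> fi gi; exact: (integrableB mD fi gi). Qed.

Section Pair.
Variables a b a' b' : R.
Hypotheses (b'1 : -1 < b') (bb' : b' < b) (ba : b <= a) (sumE : a + b = a' + b').

Let b1 : -1 < b. Proof. exact: lt_trans bb'. Qed.
Let a1 : -1 < a. Proof. exact: lt_le_trans ba. Qed.
Let aa' : a < a'. Proof. by rewrite -(ltrD2r b') -sumE ltrD2l. Qed.
Let a'1 : -1 < a'. Proof. exact: lt_trans aa'. Qed.
Let al := (a - b) / 2.
Let be := (a' - b') / 2.
Let al0 : 0 <= al. Proof. by rewrite divr_ge0// subr_ge0. Qed.
Let albe : al < be.
Proof. by rewrite ltr_pM2r ?invr_gt0// ltrD// ltrN2. Qed.

Let be0 : 0 <= be. Proof. exact: ltW (le_lt_trans al0 albe). Qed.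

Let base (y r : R) := r `^ ((a + b) / 2) * (1 + r) `^ (- (a + b + 2)) *
  expR (- (y * (spread r / 2))).

Let base_gt0 y r : 0 < r -> 0 < base y r.
Proof. by move=> r0; rewrite !mulr_gt0 ?powR_gt0 ?expR_gt0 ?addr_gt0. Qed.

Let weightE y r : 0 < r -> ratio_weight a b y r = base y r * ch2 (al * ln r).
Proof. by move=> r0; rewrite /ratio_weight powR_add_ch2// /base -/al; ring. Qed.

Let weightE' y r : 0 < r -> ratio_weight a' b' y r = base y r * ch2 (be * ln r).
Proof.
by move=> r0; rewrite /ratio_weight powR_add_ch2// /base -/be -sumE; ring.
Qed.

(** Strict away from r = 1, since al < be. *)
Lemma ratio_integral_lt y : 0 <= y -> ratio_integral a b y < ratio_integral a' b' y.
Proof.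
move=> y0; rewrite -subr_gt0 /ratio_integral.
have i1 := ratio_integrable a1 b1 y0; have i2 := ratio_integrable a'1 b'1 y0.
rewrite -RintegralB//.
have lt_al (r : R) : r != 0 -> `|al * r| < `|be * r|.
  move=> r0; rewrite (normrM al) (normrM be) ltr_pM2r ?normr_gt0//.
  by rewrite (ger0_norm al0) (ger0_norm be0).
apply: (@Rintegral_gt0 _ _ 1 2); rewrite ?ltr1n//.
- exact: iB.
- move=> r r0; rewrite weightE// weightE'// -mulrBr mulr_ge0 ?(ltW (base_gt0 _ _))//.
  rewrite subr_ge0; apply: ch2_le.
  have [->|/lt_al/ltW//] := eqVneq (ln r) 0; by rewrite !mulr0.
- move=> r /andP[r1 _]; have r0 : 0 < r by exact: lt_trans r1.
  rewrite weightE// weightE'// -mulrBr mulr_gt0 ?base_gt0// subr_gt0 ch2_lt// lt_al//.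
  by rewrite gt_eqF// ln_gt0.
Qed.

(** The quotient ch2 (al * l) / ch2 (be * l) is 1 at l = 0 and at most
    2 exp (- (be - al) l), hence takes every value c in ]0, 1[. *)
Lemma ch2_crossing (c : R) : 0 < c -> c < 1 ->
  exists2 l, 0 < l & ch2 (al * l) = c * ch2 (be * l).
Proof.
move=> c0 c1.
pose f l := ch2 (al * l) - c * ch2 (be * l).
have cch (k : R) : continuous (fun l => ch2 (k * l)).
  have ce (m : R) : continuous (fun l : R => expR (m * l)).
    move=> l; apply: (@continuous_comp _ _ _ ( *%R m) expR).
      exact: mulrl_continuous.
    exact: continuous_expR.
  move=> l; rewrite /ch2; apply: cvgD; first exact: ce.
  under eq_fun do rewrite -mulNr.
  by rewrite -mulNr; exact: ce.
have cf : continuous f.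
  by move=> l; apply: cvgB; [exact: cch|apply: cvgMr; exact: cch].
(* 2 exp (al * M) = c exp (be * M) *)
pose M := ln (2 / c) / (be - al).
have M0 : 0 < M.
  by rewrite divr_gt0 ?subr_gt0// ln_gt0// ltr_pdivlMr//; lra.
have f0 : 0 < f 0 by rewrite /f /ch2 !mulr0 oppr0 expR0; lra.
have fM : f M <= 0.
  rewrite subr_le0 /ch2.
  have aM : 0 <= al * M by rewrite mulr_ge0// ltW.
  rewrite (@le_trans _ _ (2 * expR (al * M)))//.
    rewrite mulrDl mul1r lerD2l ler_expR; lra.
  rewrite (@le_trans _ _ (c * expR (be * M)))//; last first.
    by rewrite ler_wpM2l ?(ltW c0)// lerDl expR_ge0.
  have -> : be * M = al * M + ln (2 / c).
    by rewrite /M; field; rewrite gt_eqF// subr_gt0.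
  rewrite expRD lnK ?posrE ?divr_gt0// [c * _](_ : _ = 2 * expR (al * M))//.
  by field; rewrite gt_eqF.
have [|l lM fl] := @IVT R f 0 M 0 (ltW M0) (continuous_subspaceT cf).
  by rewrite ge_min le_max fM (ltW f0) orbT.
exists l; last by apply/eqP; rewrite -subr_eq0 -/(f l) fl.
move: lM; rewrite in_itv/= => /andP[+ _].
rewrite le_eqVlt => /predU1P[l0|//].
by move: fl f0; rewrite -l0 => ->; rewrite ltxx.
Qed.

Let ratio_integral_gt0 : 0 < ratio_integral a b 0.
Proof.
apply: (@Rintegral_gt0 _ _ 0 1) => //.
- exact: ratio_integrable.
- by move=> r _; exact: ratio_weight_ge0.
- move=> r /andP[r0 _].
  by rewrite weightE// mulr_gt0 ?base_gt0// ch2_gt0.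
Qed.

(** With c the quotient of the integrals at y = 0, subtracting a multiple of
    the vanishing difference at y = 0 changes nothing.  The multiple is the
    value of the Gaussian factor at the crossing point |ln r| = l, so that both
    factors of the new integrand change sign there simultaneously. *)
Lemma ratio_integral_gt y : 0 < y ->
  ratio_integral a b 0 / ratio_integral a' b' 0 * ratio_integral a' b' y
  < ratio_integral a b y.
Proof.
move=> y0.
have K0 : 0 < ratio_integral a b 0.
  exact: ratio_integral_gt0.
have K'0 := lt_trans K0 (ratio_integral_lt (lexx 0)).
set c := _ / _.
have c0 : 0 < c := divr_gt0 K0 K'0.
have c1 : c < 1 by rewrite ltr_pdivrMr// mul1r ratio_integral_lt.
have cK : ratio_integral a b 0 - c * ratio_integral a' b' 0 = 0.
  by rewrite /c divfK ?subrr// gt_eqF.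
have [l l0 lE] := ch2_crossing c0 c1.
pose E (z : R) := expR (- (y * (z / 2))).
pose Es := E (spread (expR l)).
rewrite -subr_gt0.
have {cK} -> : ratio_integral a b y - c * ratio_integral a' b' y =
  (ratio_integral a b y - c * ratio_integral a' b' y) -
  Es * (ratio_integral a b 0 - c * ratio_integral a' b' 0).
  by rewrite cK mulr0 subr0.
have sub z : 0 <= z -> ratio_integral a b z - c * ratio_integral a' b' z =
    \int[mu]_(r in D) (ratio_weight a b z r - c * ratio_weight a' b' z r).
  move=> z0; have i' := ratio_integrable a'1 b'1 z0.
  rewrite RintegralB ?RintegralZl//; first exact: ratio_integrable.
  exact: iZ.
have iw z : 0 <= z -> mu.-integrable D
    (EFin \o (fun r => ratio_weight a b z r - c * ratio_weight a' b' z r)).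
  by move=> z0; apply: iB; [|apply: iZ]; exact: ratio_integrable.
rewrite (sub _ (ltW y0)) (sub _ (lexx 0)).
rewrite -(RintegralZl Es)//; last exact: iw.
rewrite -RintegralB//; [|exact/iw/ltW|exact/iZ/iw].
have wE r : 0 < r -> ratio_weight a b y r - c * ratio_weight a' b' y r -
    Es * (ratio_weight a b 0 r - c * ratio_weight a' b' 0 r) =
  base 0 r * ((ch2 (al * ln r) - c * ch2 (be * ln r)) * (E (spread r) - Es)).
  move=> r0; rewrite !weightE// !weightE'//.
  have -> : base y r = base 0 r * E (spread r).
    by rewrite /base /E mul0r oppr0 expR0 mulr1.
  by ring.
have pos r : 0 < r -> `|ln r| != l ->
    0 < (ch2 (al * ln r) - c * ch2 (be * ln r)) * (E (spread r) - Es).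
  move=> r0 rl.
  have Elt s t : (E s < E t) = (t < s).
    by rewrite ltr_expR ltrN2 ltr_pM2l// ltr_pM2r.
  rewrite -(ch2_norm (al * ln r)) -(ch2_norm (be * ln r)) (normrM al) (normrM be).
  rewrite (ger0_norm al0) (ger0_norm be0).
  have l0' : `|ln (expR l)| = l by rewrite expRK gtr0_norm.
  have chl0 := ch2_gt0 (be * l).
  move: rl; rewrite neq_lt => /orP[rl|rl].
    rewrite mulr_gt0// subr_gt0.
      have := ch2_ratio al0 albe (normr_ge0 _) rl.
      by rewrite lE -mulrA [_ * ch2 (be * `|_|)]mulrC mulrA ltr_pM2r.
    by rewrite Elt spread_lt ?expR_gt0// l0'.
  rewrite nmulr_rgt0 subr_lt0.
    by rewrite Elt spread_lt ?expR_gt0// l0'.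
  have := ch2_ratio al0 albe (ltW l0) rl.
  by rewrite lE -mulrA [ch2 (be * l) * _]mulrC mulrA ltr_pM2r.
apply: (@Rintegral_gt0 _ _ 1 (expR l)) => //.
- by rewrite -expR0 ltr_expR.
- by apply: iB; [exact/iw/ltW|exact/iZ/iw].
- move=> r r0; rewrite wE// mulr_ge0 ?(ltW (base_gt0 _ _))//.
  have [rl|rl] := eqVneq `|ln r| l; last exact/ltW/pos.
  rewrite -(ch2_norm (al * ln r)) -(ch2_norm (be * ln r)) (normrM al) (normrM be).
  rewrite (ger0_norm al0) (ger0_norm be0) rl lE.
  by rewrite subrr mul0r.
- move=> r /andP[r1 rl]; have r0 : 0 < r by exact: lt_trans r1.
  rewrite wE// mulr_gt0 ?base_gt0// pos//.
  have lnr : ln r < l by rewrite -(expRK l) ltr_ln// posrE expR_gt0.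
  by rewrite gtr0_norm ?ln_gt0// lt_eqF.
Qed.

End Pair.
End Chebyshev.

(** * The case of two exponents *)

Section Pair.
Context {R : realType}.
Local Notation mu := (@lebesgue_measure R).
Local Notation D := (`]0%R, +oo[%classic : set (measurableTypeR R)).
Local Notation cm := (@completely_monotonic R `]0, +oo[).

Lemma laplace_sub_cm f g (c : R) : laplace_density f -> laplace_density g ->
  (forall t, 0 < t -> c * g t < f t) ->
  cm (fun x => laplace f x - c * laplace g x) /\
  forall x, 0 < x -> c * laplace g x < laplace f x.
Proof.
move=> df dg cgf; have [mf f0 _] := df; have [mg g0 _] := dg.
have mD : measurable D by exact: measurable_itv.
pose h t := f t - c * g t.
have h0 t : 0 < t -> 0 < h t by move=> t0; rewrite subr_gt0 cgf.
have icg x : 0 < x ->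
    mu.-integrable D (EFin \o (fun t => c * (g t * expR (- (x * t))))).
  by move=> x0; exact: (integrableZl mD c (laplace_integrable dg x0)).
have ifg x : 0 < x -> mu.-integrable D
    (EFin \o (fun t => f t * expR (- (x * t)) - c * (g t * expR (- (x * t))))).
  by move=> x0; exact: (integrableB mD (laplace_integrable df x0) (icg _ x0)).
have dh : laplace_density h.
  split; [by rewrite /h; prove_measurable|by move=> t /h0/ltW|move=> x x0].
  have /integrableP[_] := ifg x x0.
  apply: le_lt_trans; rewrite le_eqVlt; apply/orP; left; apply/eqP.
  apply: eq_integral => t /half_line_gt0 t0; rewrite /= ger0_norm.
    by rewrite mulrBl mulrA.
  by rewrite mulrA -mulrBl mulr_ge0 ?expR_ge0// ltW// h0.
have hE x : 0 < x -> laplace h x = laplace f x - c * laplace g x.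
  move=> x0; rewrite /laplace -RintegralZl//; last exact: laplace_integrable.
  rewrite -RintegralB//; [|exact: laplace_integrable|exact: icg].
  by apply: eq_Rintegral => t _; rewrite mulrBl mulrA.
split; first exact: eq_cm hE (cm_laplace dh).
by move=> x x0; rewrite -subr_gt0 -hE// laplace_gt0.
Qed.

Lemma laplace_ratio (a b x : R) : -1 < a -> -1 < b -> 0 < x ->
  laplace (ratio_density a b) x = 2 * (laplace_gauss a x * laplace_gauss b x).
Proof.
move=> a1 b1 x0; apply/eqP; rewrite -eqe -laplace_gauss_mulE//.
by rewrite (EFin_laplace (laplace_density_ratio a1 b1) x0).
Qed.

Variables a b a' b' : R.
Hypotheses (b'1 : -1 < b') (bb' : b' < b) (ba : b <= a) (sumE : a + b = a' + b').

Let b1 : -1 < b. Proof. exact: lt_trans bb'. Qed.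
Let a1 : -1 < a. Proof. exact: lt_le_trans ba. Qed.
Let a'1 : -1 < a'.
Proof. by apply: (lt_trans a1); rewrite -(ltrD2r b') -sumE ltrD2l. Qed.

Lemma laplace_gauss_mul_upper :
  cm (fun x => laplace_gauss a' x * laplace_gauss b' x -
               laplace_gauss a x * laplace_gauss b x) /\
  forall x, 0 < x -> laplace_gauss a x * laplace_gauss b x <
                     laplace_gauss a' x * laplace_gauss b' x.
Proof.
have [|cmP ltP] := laplace_sub_cm (laplace_density_ratio a'1 b'1)
    (laplace_density_ratio a1 b1) (c := 1).
  move=> t t0; rewrite mul1r /ratio_density sumE ltr_pM2l ?powR_gt0//.
  by apply: ratio_integral_lt; rewrite ?sqr_ge0.
split.
  apply: eq_cm (cmZ (c := 2^-1) _ cmP); last by [].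
  by move=> x x0 /=; rewrite mul1r !laplace_ratio// -mulrBr mulKf ?pnatr_eq0.
by move=> x /[dup] x0 /ltP; rewrite mul1r !laplace_ratio// ltr_pM2l.
Qed.

Lemma laplace_gauss_mul_lower :
  let c := Gamma (a + 1) * Gamma (b + 1) / (Gamma (a' + 1) * Gamma (b' + 1)) in
  cm (fun x => laplace_gauss a x * laplace_gauss b x -
               c * (laplace_gauss a' x * laplace_gauss b' x)) /\
  forall x, 0 < x -> c * (laplace_gauss a' x * laplace_gauss b' x) <
                     laplace_gauss a x * laplace_gauss b x.
Proof.
move=> c.
have cE : c = ratio_integral a b 0 / ratio_integral a' b' 0.
  have G0 : 0 < Gamma (a + b + 2).
    have ab1 : -1 < a + b + 1 by have := a1; have := b1; lra.
    by rewrite (_ : a + b + 2 = a + b + 1 + 1) ?Gamma_gt0//; ring.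
  move: (Gamma_mul a1 b1) (Gamma_mul a'1 b'1) (Gamma_gt0 a'1) (Gamma_gt0 b'1) G0.
  rewrite /c -sumE.
  move: (ratio_integral a b 0) (ratio_integral a' b' 0) (Gamma (a + b + 2)).
  move: (Gamma (a + 1)) (Gamma (b + 1)) (Gamma (a' + 1)) (Gamma (b' + 1)).
  move=> ga gb ga' gb' k k' g E E' ga'0 gb'0 g0.
  have -> : ga * gb = g * k / 2 by rewrite -E [RHS]mulrC mulKf ?pnatr_eq0.
  have E2 : ga' * gb' = g * k' / 2 by rewrite -E' [RHS]mulrC mulKf ?pnatr_eq0.
  have k'0 : k' != 0.
    apply/eqP => k'0; have := mulr_gt0 ga'0 gb'0.
    by rewrite E2 k'0 mulr0 mul0r ltxx.
  by rewrite E2; field; rewrite k'0 gt_eqF.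
have [|cmP ltP] := laplace_sub_cm (laplace_density_ratio a1 b1)
    (laplace_density_ratio a'1 b'1) (c := c).
  move=> t t0; rewrite /ratio_density -sumE mulrCA ltr_pM2l ?powR_gt0//.
  by rewrite cE; apply: ratio_integral_gt; rewrite ?exprn_gt0.
split.
  apply: eq_cm (cmZ (c := 2^-1) _ cmP); last by [].
  move=> x x0 /=; rewrite !laplace_ratio// [c * (2 * _)]mulrCA -mulrBr.
  by rewrite mulKf ?pnatr_eq0.
by move=> x /[dup] x0 /ltP; rewrite !laplace_ratio// mulrCA ltr_pM2l.
Qed.

End Pair.

(** * Behaviour at infinity *)

Section Asymptotics.
Context {R : realType}.
Local Notation mu := (@lebesgue_measure R).
Local Notation D := (`]0%R, +oo[%classic : set (measurableTypeR R)).

Lemma laplace_gaussw0E (a x : R) : -1 < a -> 0 < x ->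
  laplace (gaussw 0 a) x = x `^ (- (a + 1)) * Gamma (a + 1).
Proof.
move=> a1 x0; apply/eqP; rewrite -eqe -EFin_laplace//; last exact: laplace_density_gaussw.
rewrite EFinM -integral_powR_expR_Gamma// -integral_powR_expR//; apply/eqP.
by apply: eq_integral => t _; rewrite /gaussw mul0r oppr0 expR0 mulr1.
Qed.

Lemma laplace_gauss_gt0 (a x : R) : -1 < a -> 0 < x -> 0 < laplace_gauss a x.
Proof.
move=> a1 x0; rewrite -laplace_gaussw1; apply: laplace_gt0 => //.
  exact: laplace_density_gaussw.
by move=> t t0; rewrite mulr_gt0 ?powR_gt0 ?expR_gt0.
Qed.

(** From 1 - u <= e^-u <= 1 at u = t^2 / 2, integrated against t^a e^(-x t). *)
Lemma laplace_gauss_bounds (a x : R) : -1 < a -> 0 < x ->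
  Gamma (a + 1) - Gamma (a + 3) / 2 * x ^- 2 <= x `^ (a + 1) * laplace_gauss a x
    <= Gamma (a + 1).
Proof.
move=> a1 x0; have a3 : -1 < a + 2 by lra.
have mD : measurable D by exact: measurable_itv.
have d0 := laplace_density_gaussw (lexx 0) a1.
have d1 := laplace_density_gaussw ler01 a1.
have d2 := laplace_density_gaussw (lexx 0) a3.
have xa : 0 < x `^ (a + 1) by rewrite powR_gt0.
have gaussw0 c t : gaussw 0 c t = t `^ c by rewrite /gaussw mul0r oppr0 expR0 mulr1.
have xE c : x `^ (a + 1) * (x `^ (- (a + 1)) * c) = c.
  by rewrite powRN mulVKf// gt_eqF.
rewrite -laplace_gaussw1; apply/andP; split; last first.
  rewrite -[leRHS]xE -(laplace_gaussw0E a1 x0) (ler_pM2l xa).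
  apply: (le_Rintegral mD (laplace_integrable d1 x0) (laplace_integrable d0 x0)).
  move=> t; rewrite /= in_itv/= andbT => t0; rewrite ler_wpM2r ?expR_ge0//.
  rewrite gaussw0 /gaussw mul1r ler_piMr ?powR_ge0// -expR0 ler_expR oppr_le0.
  by rewrite divr_ge0// sqr_ge0.
have -> : Gamma (a + 1) - Gamma (a + 3) / 2 * x ^- 2 =
    x `^ (a + 1) * (laplace (gaussw 0 a) x - 2^-1 * laplace (gaussw 0 (a + 2)) x).
  rewrite mulrBr (laplace_gaussw0E a1 x0) xE (laplace_gaussw0E a3 x0); congr (_ - _).
  have -> : - (a + 2 + 1) = - (a + 1) - 2%:R by ring.
  rewrite [x `^ (_ - 2%:R)]powRD; last by apply/implyP => _; rewrite gt_eqF.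
  rewrite powRN powR_invn ?ltW//.
  have -> : a + 2 + 1 = a + 3 by ring.
  by field; rewrite !gt_eqF.
rewrite ler_pM2l// /laplace -RintegralZl//; last exact: laplace_integrable.
have i2 : mu.-integrable D
    (EFin \o (fun t => 2^-1 * (gaussw 0 (a + 2) t * expR (- (x * t))))).
  exact: (integrableZl mD 2^-1 (laplace_integrable d2 x0)).
rewrite -(RintegralB mD (laplace_integrable d0 x0) i2).
apply: (le_Rintegral mD (integrableB mD (laplace_integrable d0 x0) i2)
  (laplace_integrable d1 x0)).
move=> t; rewrite /= in_itv/= andbT => t0.
rewrite mulrA -mulrBl ler_wpM2r ?expR_ge0// !gaussw0 /gaussw mul1r.
rewrite powRD; last by apply/implyP => _; rewrite gt_eqF.
have -> : t `^ 2 = t ^+ 2 by rewrite powR_mulrn// ltW.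
rewrite [leLHS](_ : _ = t `^ a * (1 + - (t ^+ 2 / 2))); last by ring.
by rewrite ler_wpM2l ?powR_ge0// expR_ge1Dx.
Qed.

Lemma laplace_gauss_cvg (a : R) : -1 < a ->
  x `^ (a + 1) * laplace_gauss a x @[x --> +oo] --> Gamma (a + 1).
Proof.
move=> a1.
have pos : \forall x \near +oo, (0 : R) < x.
  by apply: nbhs_pinfty_gt; rewrite num_real.
apply: (@squeeze_cvgr _ _ _ _ (fun x => Gamma (a + 1) - Gamma (a + 3) / 2 * x ^- 2)
  (fun=> Gamma (a + 1))).
- by apply: filterS pos => x; exact: laplace_gauss_bounds.
- rewrite -[X in _ --> X]subr0 -[X in _ - X](mulr0 (Gamma (a + 3) / 2)).
  apply: cvgB; first exact: cvg_cst.
  apply: cvgMr.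
  apply/(gtr0_cvgV0 (f := fun x : R => x ^+ 2)); last exact: cvgr_expr2.
  by apply: filterS pos => x x0; rewrite exprn_gt0.
- exact: cvg_cst.
Qed.

End Asymptotics.

(** * From two exponents to majorization *)

Section Majorization.
Context {R : realType} (n : nat).
Local Notation cm := (@completely_monotonic R `]0, +oo[).
Implicit Types u v w : 'I_n -> R.

Definition gauss_prod u (x : R) : R := \prod_(j < n) laplace_gauss (u j) x.
Definition Gamma_prod u : R := \prod_(j < n) Gamma (u j + 1).

(** The content of the theorem at the two extreme values of lambda.  In this
    form it composes along chains of exponent vectors. *)
Definition sandwiched u v : Prop :=
  [/\ cm (fun x => gauss_prod v x - gauss_prod u x),
      forall x, 0 < x -> gauss_prod u x < gauss_prod v x,
      cm (fun x => gauss_prod u x - Gamma_prod u / Gamma_prod v * gauss_prod v x) &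
      forall x, 0 < x ->
        Gamma_prod u / Gamma_prod v * gauss_prod v x < gauss_prod u x].

Lemma Gamma_prod_gt0 u : (forall i, -1 < u i) -> 0 < Gamma_prod u.
Proof. by move=> u1; apply: prodr_gt0 => i _; exact: Gamma_gt0. Qed.

Lemma gauss_prod_gt0 u x : (forall i, -1 < u i) -> 0 < x -> 0 < gauss_prod u x.
Proof. by move=> u1 x0; apply: prodr_gt0 => i _; exact: laplace_gauss_gt0. Qed.

(** The constants multiply along the chain, so the differences telescope with
    nonnegative coefficients. *)
Lemma sandwiched_trans u v w :
  (forall i, -1 < u i) -> (forall i, -1 < v i) -> (forall i, -1 < w i) ->
  sandwiched u v -> sandwiched v w -> sandwiched u w.
Proof.
move=> /Gamma_prod_gt0 + /Gamma_prod_gt0 + /Gamma_prod_gt0.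
rewrite /sandwiched; move: (Gamma_prod u) (Gamma_prod v) (Gamma_prod w) => a b c.
move: (gauss_prod u) (gauss_prod v) (gauss_prod w) => U V W a0 b0 c0.
move=> [cuv luv cuv' luv'] [cvw lvw cvw' lvw'].
have ab0 : 0 < a / b by rewrite divr_gt0.
have cE : a / c = a / b * (b / c) by rewrite mulrA divfK ?gt_eqF.
split.
- by apply: eq_cm (cmD cvw cuv) => x _; rewrite addrA subrK.
- by move=> x x0; apply: lt_trans (luv _ x0) (lvw _ x0).
- apply: eq_cm (cmD cuv' (cmZ (ltW ab0) cvw')) => x _.
  by rewrite cE mulrBr addrA subrK [in LHS]mulrA.
- move=> x x0; apply: lt_trans (luv' _ x0).
  by rewrite cE -mulrA ltr_pM2l// lvw'.
Qed.

Lemma cm_laplace_gauss (a : R) : -1 < a -> cm (laplace_gauss a).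
Proof.
move=> a1; apply: eq_cm (cm_laplace (laplace_density_gaussw ler01 a1)) => x _.
exact: laplace_gaussw1.
Qed.

Lemma sandwiched_transfer u v (j k : 'I_n) : j != k ->
  (forall i, -1 < u i) -> (forall i, -1 < v i) ->
  (forall i, i != j -> i != k -> u i = v i) ->
  u j + u k = v j + v k -> u k <= u j -> v k < u k ->
  sandwiched u v.
Proof.
move=> jk u1 v1 uv sumE ukj vuk.
pose Q x := \prod_(i < n | (i != j) && (i != k)) laplace_gauss (u i) x.
pose g := \prod_(i < n | (i != j) && (i != k)) Gamma (u i + 1).
have kj : k != j by rewrite eq_sym.
have split2 (F : 'I_n -> R) : \prod_(i < n) F i =
    F j * F k * \prod_(i < n | (i != j) && (i != k)) F i.
  by rewrite (bigD1 j)//= (bigD1 k)//= mulrA.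
have PuE x : gauss_prod u x = laplace_gauss (u j) x * laplace_gauss (u k) x * Q x.
  exact: split2.
have PvE x : gauss_prod v x = laplace_gauss (v j) x * laplace_gauss (v k) x * Q x.
  rewrite /gauss_prod split2; congr (_ * _); apply: eq_bigr => i /andP[ij ik].
  by rewrite uv.
have g0 : 0 < g by apply: prodr_gt0 => i _; exact: Gamma_gt0.
have GE : Gamma_prod u / Gamma_prod v = Gamma (u j + 1) * Gamma (u k + 1) /
    (Gamma (v j + 1) * Gamma (v k + 1)).
  have GuE : Gamma_prod u = Gamma (u j + 1) * Gamma (u k + 1) * g by exact: split2.
  have GvE : Gamma_prod v = Gamma (v j + 1) * Gamma (v k + 1) * g.
    rewrite /Gamma_prod split2; congr (_ * _); apply: eq_bigr => i /andP[ij ik].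
    by rewrite uv.
  by rewrite GuE GvE -mulf_div divff ?mulr1// gt_eqF.
have cQ : cm Q by apply: cm_prod => i _; exact: cm_laplace_gauss.
have Q0 x : 0 < x -> 0 < Q x.
  by move=> x0; apply: prodr_gt0 => i _; exact: laplace_gauss_gt0.
have [cU lU] := laplace_gauss_mul_upper (v1 k) vuk ukj sumE.
have [cL lL] := laplace_gauss_mul_lower (v1 k) vuk ukj sumE.
rewrite /sandwiched GE; split.
- by apply: eq_cm (cmM cU cQ) => x _; rewrite PuE PvE mulrBl.
- by move=> x x0; rewrite PuE PvE ltr_pM2r ?Q0// lU.
- by apply: eq_cm (cmM cL cQ) => x _; rewrite PuE PvE mulrBl [in RHS]mulrA.
- by move=> x x0; rewrite PuE PvE mulrA ltr_pM2r ?Q0// lL.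
Qed.

Lemma ltr_sum_at (I : finType) (P : pred I) (u v : I -> R) k :
  (forall i, P i -> i != k -> v i <= u i) -> P k -> v k < u k ->
  \sum_(i | P i) v i < \sum_(i | P i) u i.
Proof.
move=> vu Pk vuk; rewrite (bigD1 k)// [ltRHS](bigD1 k)//=.
by apply: ltr_leD => //; apply: ler_sum => i /andP[]; exact: vu.
Qed.

(** Muirhead's transfers, by induction on the number of coordinates where u and
    v differ.  Let k be the first index with v k < u k; the partial sum up to k
    yields j < k with u j < v j.  Moving the largest admissible amount d from
    v j to v k makes one more coordinate agree with u.  Neither partial sums
    nor their total suffer: before k the new vector dominates u termwise, and
    beyond k its partial sums are those of v.  As u is sorted, u k <= u j, so
    the two moved values stay in the order that the two-exponent case needs. *)
Lemma majorized_sandwiched u v :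
  (forall i, -1 < u i) -> (forall i, -1 < v i) ->
  (forall i j : 'I_n, (i <= j)%N -> u j <= u i) ->
  (forall m, \sum_(j < n | (j < m)%N) u j <= \sum_(j < n | (j < m)%N) v j) ->
  \sum_(j < n) u j = \sum_(j < n) v j ->
  u <> v -> sandwiched u v.
Proof.
move=> u1 + udec; have [N] := ubnP #|[pred i | u i != v i]|.
elim: N v => // N IH v leN v1 ple sumE uv.
have [k0 vk0] : exists k, v k < u k.
  apply: contrapT => /forallNP h; apply: uv; apply/funext => i.
  have {}h k : u k <= v k by rewrite leNgt; apply/negP; exact: h.
  apply/eqP; move: (h i); rewrite le_eqVlt => /predU1P[->//|ui].
  have := @ltr_sum_at _ xpredT v u i (fun k _ _ => h k) isT ui.
  by rewrite sumE ltxx.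
have [k vk kmin] := @arg_minnP _ k0 (fun k => v k < u k) (@nat_of_ord n) vk0.
have below (i : 'I_n) : (i < k)%N -> u i <= v i.
  by move=> ik; rewrite leNgt; apply/negP => /kmin; rewrite leqNgt ik.
have [j jk uj] : exists2 j : 'I_n, (j < k)%N & u j < v j.
  apply: contrapT => h.
  have hj (j : 'I_n) : (j < k)%N -> v j <= u j.
    by move=> jk; rewrite leNgt; apply/negP => uj; apply: h; exists j.
  have := ple k.+1; rewrite leNgt => /negP; apply.
  apply: (ltr_sum_at (k := k)) => // i; rewrite ltnS leq_eqVlt => /orP[|/hj//].
  by move=> /eqP/val_inj ->; rewrite eqxx.
have jk' : j != k by apply: contraTneq jk => ->; rewrite ltnn.
have kj' : k != j by rewrite eq_sym.
have ukj : u k <= u j by apply: udec; exact: ltnW.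
pose d := Num.min (v j - u j) (u k - v k).
have d0 : 0 < d by rewrite lt_min !subr_gt0 uj.
have dj : d <= v j - u j by rewrite ge_min lexx.
have dk : d <= u k - v k by rewrite ge_min lexx orbT.
pose v' i := if i == j then v j - d else if i == k then v k + d else v i.
have v'j : v' j = v j - d by rewrite /v' eqxx.
have v'k : v' k = v k + d by rewrite /v' (negbTE kj') eqxx.
have v'E i : i != j -> i != k -> v' i = v i.
  by rewrite /v' => /negbTE -> /negbTE ->.
have v'1 i : -1 < v' i.
  rewrite /v'; case: ifP => _; first by apply: (lt_le_trans (u1 j)); lra.
  by case: ifP => _ //; apply: (lt_le_trans (v1 k)); lra.
have sv' : sandwiched v' v.
  have e1 : v' j + v' k = v j + v k by rewrite v'j v'k; lra.
  have e2 : v' k <= v' j by rewrite v'j v'k; lra.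
  have e3 : v k < v' k by rewrite v'k; lra.
  exact: (sandwiched_transfer jk' v'1 v1 v'E e1 e2 e3).
(* A sum over indices that include both j and k ignores the transfer. *)
have moved (P : pred 'I_n) : P j -> P k ->
    \sum_(i | P i) v' i = \sum_(i | P i) v i.
  move=> Pj Pk; rewrite (bigD1 j)// [RHS](bigD1 j)//=.
  rewrite (bigD1 k) ?Pk//= [in RHS](bigD1 k) ?Pk//= v'j v'k.
  rewrite (eq_bigr v) => [|i /andP[/andP[_ ij] ik]]; last exact: v'E.
  by rewrite [v k + d]addrC addrA addrA subrK -addrA.
have [->//|uv'] := pselect (u = v').
apply: (sandwiched_trans u1 v'1 v1 _ sv'); apply: IH => //.
- rewrite -ltnS; apply: leq_trans leN; rewrite ltnS.
  apply: proper_card; apply/properP; split.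
    apply/fintype.subsetP => i; rewrite !inE; apply: contraNneq => uvi.
    rewrite /v'; case: (i =P j) => [ij|_]; first by move: uj; rewrite -ij uvi ltxx.
    case: (i =P k) => [ik|_]; last by rewrite uvi.
    by move: vk; rewrite -ik uvi ltxx.
  have [dE|dE] : d = v j - u j \/ d = u k - v k.
    by rewrite /d /Num.min; case: ifP => _; [left|right].
    exists j; rewrite !inE; first by rewrite lt_eqF.
    by rewrite v'j dE opprB addrC subrK eqxx.
  exists k; rewrite !inE; first by rewrite gt_eqF.
  by rewrite v'k dE addrC subrK eqxx.
- move=> m; have [mk|km] := leqP m k.
    apply: ler_sum => i im; have ik : (i < k)%N by exact: leq_trans mk.
    rewrite /v'; case: eqP => [->|_]; first by lra.
    case: eqP => [ik'|_]; last exact: below.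
    by move: ik; rewrite ik' ltnn.
  rewrite (le_trans (ple m))// moved//; exact: ltn_trans km.
- rewrite sumE; apply/esym; exact: (moved xpredT).
Qed.

End Majorization.

(** * The optimal constant *)

Section Limit.
Context {R : realType} (n : nat).
Implicit Types u v : 'I_n -> R.

Lemma gauss_prod_cvg u : (forall i, -1 < u i) ->
  x `^ (\sum_(i < n) (u i + 1)) * gauss_prod u x @[x --> +oo] --> Gamma_prod u.
Proof.
move=> u1.
have xprod x : 0 < x -> x `^ (\sum_(i < n) (u i + 1)) * gauss_prod u x =
    \prod_(i < n) (x `^ (u i + 1) * laplace_gauss (u i) x).
  move=> x0; rewrite [RHS]big_split/=; congr (_ * _).
  apply: (big_rec2 (fun s p => x `^ s = p)); first by rewrite powRr0.
  by move=> i p s _ <-; rewrite powRD//; apply/implyP => _; rewrite gt_eqF.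
have pos : \forall x \near +oo, (0 : R) < x.
  by apply: nbhs_pinfty_gt; rewrite num_real.
have h : \prod_(i < n) (x `^ (u i + 1) * laplace_gauss (u i) x) @[x --> +oo]
    --> Gamma_prod u.
  apply: cvg_big => [|i _]; last exact: laplace_gauss_cvg.
  exact: mul_continuous.
apply: cvg_trans h; apply: near_eq_cvg.
by apply: filterS pos => x x0; rewrite xprod.
Qed.

(** The powers of x cancel because the exponents have the same sum. *)
Lemma gauss_prod_ratio_cvg u v : (forall i, -1 < u i) -> (forall i, -1 < v i) ->
  \sum_(i < n) u i = \sum_(i < n) v i ->
  gauss_prod u x / gauss_prod v x @[x --> +oo] --> Gamma_prod u / Gamma_prod v.
Proof.
move=> u1 v1 uv.
have pos : \forall x \near +oo, (0 : R) < x.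
  by apply: nbhs_pinfty_gt; rewrite num_real.
have Gv0 : Gamma_prod v != 0 by rewrite gt_eqF// Gamma_prod_gt0.
have h : (x `^ (\sum_(i < n) (u i + 1)) * gauss_prod u x) /
    (x `^ (\sum_(i < n) (v i + 1)) * gauss_prod v x) @[x --> +oo] -->
    Gamma_prod u / Gamma_prod v.
  exact: cvgM (gauss_prod_cvg u1) (cvgV Gv0 (gauss_prod_cvg v1)).
apply: cvg_trans h; apply: near_eq_cvg.
apply: filterS pos => x x0 /=.
have -> : \sum_(i < n) (u i + 1) = \sum_(i < n) (v i + 1).
  by rewrite !big_split/= uv.
have := powR_gt0 (\sum_(i < n) (v i + 1)) x0.
have := gauss_prod_gt0 v1 x0.
move: (gauss_prod u x) (gauss_prod v x) (x `^ _) => a b c b0 c0.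
by rewrite -mulf_div divff ?mul1r// gt_eqF.
Qed.

Lemma le_Gamma_ratio u v (lambda : R) :
  (forall i, -1 < u i) -> (forall i, -1 < v i) ->
  \sum_(i < n) u i = \sum_(i < n) v i ->
  (forall x, 0 < x -> lambda * gauss_prod v x <= gauss_prod u x) ->
  lambda <= Gamma_prod u / Gamma_prod v.
Proof.
move=> u1 v1 uv lu.
apply: (cvgr_to_ge (gauss_prod_ratio_cvg u1 v1 uv)).
have pos : \forall x \near +oo, (0 : R) < x.
  by apply: nbhs_pinfty_gt; rewrite num_real.
apply: filterS pos => x x0; rewrite ler_pdivlMr ?gauss_prod_gt0//.
exact: lu.
Qed.

End Limit.

Section Rows.
Context {R : realType} (n : nat).

Lemma majorized_rows (p q : 'rV[R]_n) :
  (forall j, -1 < p 0 j) -> (forall j, -1 < q 0 j) -> majorized p q ->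
  sandwiched (p 0) (q 0).
Proof.
move=> p1 q1 [qp _ pdec ple sumE]; apply: majorized_sandwiched => //.
  move=> m; have [->|m0] := posnP m; first by rewrite !big_pred0.
  have [nm|mn] := leqP n m; last first.
    by apply: ple; rewrite m0 -ltnS (ltn_predK mn).
  have all_lt (i : 'I_n) : (i < m)%N by exact: leq_trans nm.
  by rewrite (eq_bigl xpredT) // [leRHS](eq_bigl xpredT)// sumE.
by move=> pq; apply: qp; apply/rowP => j; rewrite -(congr1 (@^~ j) pq).
Qed.
End Rows.

(** * Complete monotonicity and the sharp two-sided bound *)

Theorem proposition6 (R : realType) (n : nat) (hn : (2 <= n)%N)
    (p q : 'rV[R]_n)
    (hp : forall j : 'I_n, -1 < p 0 j) (hq : forall j : 'I_n, -1 < q 0 j)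
    (hpq : majorized p q) :
  [/\ forall lambda : R,
        completely_monotonic `]0, +oo[ (fun x : R => prod_diff p q lambda x)
        <-> lambda <= \prod_(j < n) (Gamma (p 0 j + 1) / Gamma (q 0 j + 1)),
      forall lambda : R, 1 <= lambda ->
        completely_monotonic `]0, +oo[ (fun x : R => - prod_diff p q lambda x),
      forall x : R, 0 < x ->
        \prod_(j < n) (Gamma (p 0 j + 1) / Gamma (q 0 j + 1))
          < \prod_(j < n) (laplace_gauss (p 0 j) x / laplace_gauss (q 0 j) x)
          < 1
    & forall c : R,
        \prod_(j < n) (Gamma (p 0 j + 1) / Gamma (q 0 j + 1)) < c ->
        ~ (forall x : R, 0 < x ->
             c < \prod_(j < n)
                   (laplace_gauss (p 0 j) x / laplace_gauss (q 0 j) x))].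
Proof.
have [cU lU cL lL] := majorized_rows hp hq hpq.
have [_ _ _ _ sumE] := hpq.
have cE : \prod_(j < n) (Gamma (p 0 j + 1) / Gamma (q 0 j + 1)) =
    Gamma_prod (p 0) / Gamma_prod (q 0) by exact: prodf_div.
have rE x : \prod_(j < n) (laplace_gauss (p 0 j) x / laplace_gauss (q 0 j) x) =
    gauss_prod (p 0) x / gauss_prod (q 0) x by exact: prodf_div.
have dE lambda x : prod_diff p q lambda x =
    gauss_prod (p 0) x - lambda * gauss_prod (q 0) x by [].
have cq : completely_monotonic `]0, +oo[ (gauss_prod (q 0)).
  by apply: cm_prod => i _; exact: cm_laplace_gauss.
rewrite cE; split.
- move=> lambda; split=> [cD|lc].
    apply: (le_Gamma_ratio hp hq (esym sumE)) => x x0.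
    by rewrite -subr_ge0 -dE; exact: cm_ge0 cD _ x0.
  have c0 : 0 <= Gamma_prod (p 0) / Gamma_prod (q 0) - lambda by rewrite subr_ge0.
  apply: eq_cm (cmD cL (cmZ c0 cq)) => x _.
  by rewrite dE mulrBl addrA subrK.
- move=> lambda l1; have l0 : 0 <= lambda - 1 by rewrite subr_ge0.
  apply: eq_cm (cmD cU (cmZ l0 cq)) => x _.
  by rewrite dE opprB mulrBl mul1r addrC addrA subrK.
- move=> x x0; rewrite rE.
  have q0 := gauss_prod_gt0 hq x0.
  by rewrite ltr_pdivlMr// lL//= ltr_pdivrMr// mul1r lU.
- move=> c gc h; have := le_Gamma_ratio hp hq (esym sumE) (lambda := c).
  rewrite leNgt gc => /(_ _)/negP; apply => // x x0.
  by rewrite -ler_pdivlMr ?gauss_prod_gt0// -rE ltW// h.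
Qed.
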